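(* Let $a$ be a positive integer. For any integer $k\geq 2$, $$\sum_{n=1}^{k-1}2^{n-1}G_{0,2a,a}(k,n)=\sum_{n=1}^{k-1}(-1)^{k-n-1}2^{n-1}G^\star_{0,2a,a}(k,n)$$ $$=\sum_{\substack{n+n_1+\cdots+n_m=k-2\\ n,m\geq 0,\ n_1,\ldots,n_m\geq 2}}\frac{2^{n+2m}(2^{n_1-1}-1)\cdots(2^{n_m-1}-1)}{a^k\,n!\,m!\,n_1\cdots n_m(2^{n_1}-1)\cdots(2^{n_m}-1)}\,t(2)\,t(n_1)\cdots t(n_m)\log^n(2).$$
   Context: An index is a finite sequence $\mathbf{k}=(k_1,\ldots,k_n)$ of positive integers, of weight $k_1+\cdots+k_n$ and depth $n$; it is admissible if $k_1>1$. For a positive integer $N$, $a\in\{1,\ldots,N\}$ and an admissible index, $$t_{N,a}(k_1,\ldots,k_n)=\sum_{m_1>\cdots>m_n>0,\ m_i\equiv a\ (\mathrm{mod}\ N)}\frac{1}{m_1^{k_1}\cdots m_n^{k_n}},\qquad t^\star_{N,a}(k_1,\ldots,k_n)=\sum_{m_1\geq\cdots\geq m_n>0,\ m_i\equiv a\ (\mathrm{mod}\ N)}\frac{1}{m_1^{k_1}\cdots m_n^{k_n}}.$$ $I_0(k,n)$ is the set of admissible indices of weight $k$ and depth $n$, and $G_{0,N,a}(k,n)=\sum_{\mathbf{k}\in I_0(k,n)}t_{N,a}(\mathbf{k})$, $G^\star_{0,N,a}(k,n)=\sum_{\mathbf{k}\in I_0(k,n)}t^\star_{N,a}(\mathbf{k})$;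 here $N=2a$. Also $t(n)=t_{2,1}(n)=\sum_{m>0\ \mathrm{odd}}m^{-n}$ for $n\geq 2$. In the last sum, the tuple $(n_1,\ldots,n_m)$ is ordered, and for $m=0$ it is empty. *)

(* Defs.v *)
From mathcomp Require Export all_boot all_order all_algebra.
From mathcomp Require Export all_classical all_reals all_analysis.

Set Implicit Arguments.
Unset Strict Implicit.
Unset Printing Implicit Defensive.

Import Order.TTheory GRing.Theory Num.Theory.

Local Open Scope classical_set_scope.
Local Open Scope ring_scope.
Local Open Scope ereal_scope.

(* The series below have nonnegative terms, so each multiple series is the
   unordered sum of its terms in [0, +oo], over tuples (m_1, ..., m_n). *)

Definition mpos_cong (N a : nat) (n : nat) (m : n.-tuple nat) : bool :=
  all (fun x : nat => (0 < x)%N && (x == a %[mod N])%N) m.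

Definition mterm (R : realType) (n : nat) (k m : n.-tuple nat) : R :=
  (\prod_(i < n) (tnth m i)%:R ^- tnth k i)%R.

Definition tNa (R : realType) (N a n : nat) (k : n.-tuple nat) : \bar R :=
  \esum_(m in [set m : n.-tuple nat | sorted gtn m && mpos_cong N a m])
    (mterm R k m)%:E.

Definition tNa_star (R : realType) (N a n : nat) (k : n.-tuple nat) : \bar R :=
  \esum_(m in [set m : n.-tuple nat | sorted geq m && mpos_cong N a m])
    (mterm R k m)%:E.

(* The entries of an index of weight k are at most k, so I_0(k, n) is a finite
   set of tuples over 'I_k.+1. *)
Definition I0 (k n : nat) : {set n.-tuple 'I_k.+1} :=
  [set s : n.-tuple 'I_k.+1 |
    [&& all (fun x : 'I_k.+1 => (0 < x)%N) s,
        (1 < head ord0 s)%N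
      & (\sum_(x <- s) (x : nat) == k)%N]]%SET.

Definition G0 (R : realType) (N a k n : nat) : \bar R :=
  \sum_(s in I0 k n) tNa R N a (map_tuple val s).

Definition G0star (R : realType) (N a k n : nat) : \bar R :=
  \sum_(s in I0 k n) tNa_star R N a (map_tuple val s).

Definition t (R : realType) (n : nat) : R := fine (tNa R 2 1 [tuple n]).

Definition rhs_term (R : realType) (a k n m : nat) (s : seq nat) : R :=
  ((2 ^+ (n + 2 * m) * \prod_(x <- s) (2 ^+ x.-1 - 1)) /
     (a%:R ^+ k * n`!%:R * m`!%:R * \prod_(x <- s) (x%:R * (2 ^+ x - 1)))
   * (t R 2 * \prod_(x <- s) t R x) * ln 2 ^+ n)%R.

(* For k >= 2, the constraint n + n_1 + ... + n_m = k - 2 with all n_i >= 2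
   forces n, m and every n_i to be at most k - 2, so the bound k.-1 on n, m and
   the n_i discards nothing. *)
Definition rhs_sum (R : realType) (a k : nat) : R :=
  (\sum_(n < k.-1) \sum_(m < k.-1)
     \sum_(s : m.-tuple 'I_k.-1 |
            all (fun x : 'I_k.-1 => (2 <= x)%N) s
            && (n + \sum_(x <- s) (x : nat) == k - 2)%N)
       rhs_term R a k n m (map val s))%R.

(* Main.v *)
Require Import Defs.
From mathcomp Require Import all_boot all_order all_algebra.
From mathcomp Require Import all_classical all_reals all_analysis.
From mathcomp Require Import ring lra zify.

(** Summing over the largest index first, a^k times either side of the first
    equality is the coefficient of x^k in x^2 F(x), where, with o_j = 2j + 1,
      F(x) = \sum_j 1 / (o_j (o_j - x)) \prod_(i < j) (o_i + x) / (o_i - x):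
    a chain below o_j contributes 1 + 2 (x / o_i + x^2 / o_i^2 + ...) for each
    i < j in the strict case, and the signed weak sums give the same factor.
    Up to the factor 1 - x, F is a very-well-poised 5F4 series at 1 (a = 1,
    b = d = 1/2, c = (1 + x)/2). The contiguity relation a -> a + 1 of such
    series, iterated, gives F(x) = F(0) \prod_i w_i(x)^2 with
    w_i(x) = (1 - x / (2i + 2)) / (1 - x / (2i + 1)). Expanding the logarithm of
    the product and exponentiating back yields the right-hand side; the power
    series are compared through Taylor expansions at 0 on [0, 1/4]. *)

Set Implicit Arguments.
Unset Strict Implicit.
Unset Printing Implicit Defensive.

Import Order.TTheory GRing.Theory Num.Theory.
Import numFieldNormedType.Exports.

Local Open Scope classical_set_scope.
Local Open Scope ring_scope.

(** * Very-well-poised series *)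

(** Neither Gamma functions nor complex analysis enter. Dougall's sum would give the series as a
    Gamma quotient; dividing the iterated relation at x by the one at x = 0 cancels every x-free
    factor, and the remaining constant is F(0) = t(2). Power series are compared on a real interval
    only: approximation by a polynomial up to O(x^(K+1)), K = k - 2, determines the coefficients up
    to degree K. The products over i < j grow like j^x, so the interval [0, 1/4] leaves room for
    crude explicit constants. The terms at x = 1/4 are moreover a universal majorant: they dominate
    the Taylor remainders uniformly in j and the inner nested sums, so all multiple series are
    finite and may be combined with signs. *)

(* [vwp_term a b c d] is the term sequence of the very-well-poised 5F4 series
   with parameters a, 1 + a/2, b, c, d at argument 1. *)
Definition vwp_ratio (R : realType) (a b c d : R) (j : nat) : R :=
  (a + 2 * j%:R + 2) / (a + 2 * j%:R) *
  ((a + j%:R) * (b + j%:R) * (c + j%:R) * (d + j%:R) /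
   ((1 + a - b + j%:R) * (1 + a - c + j%:R) * (1 + a - d + j%:R) *
    (1 + j%:R))).

Definition vwp_term (R : realType) (a b c d : R) (M : nat) : R :=
  \prod_(j < M) vwp_ratio a b c d j.

(** Quotient of the values at a and at a + 1 of the Gamma quotient in Dougall's 5F4 summation. *)
Definition vwp_shift (R : realType) (a b c d : R) : R :=
  (1 + a - b - c) * (1 + a - b - d) * (1 + a - c - d) * (1 + a) /
  ((1 + a - b) * (1 + a - c) * (1 + a - d) * (1 + a - b - c - d)).

Lemma vwp_termS (R : realType) (a b c d : R) (M : nat) :
  vwp_term a b c d M.+1 = vwp_term a b c d M * vwp_ratio a b c d M.
Proof. by rewrite /vwp_term big_ord_recr. Qed.

Lemma vwp_term0 (R : realType) (a b c d : R) : vwp_term a b c d 0 = 1.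
Proof. by rewrite /vwp_term big_ord0. Qed.

(** Pochhammer quotients telescope, (a + 1)_M / (a)_M = (a + M) / a and likewise in the
    denominators, so the contiguity relation becomes an identity of rational functions. *)
Lemma vwp_term_succ (R : realType) (a b c d : R) (M : nat) :
  0 < a -> 0 <= b -> 0 <= c -> 0 <= d -> 0 < 1 + a - b - c - d ->
  vwp_term (a + 1) b c d M = vwp_term a b c d M *
    ((a + 1 + 2 * M%:R) / (a + 2 * M%:R) * ((a + M%:R) / (a + 1)) *
     ((1 + a - b) * (1 + a - c) * (1 + a - d)) /
     ((1 + a - b + M%:R) * (1 + a - c + M%:R) * (1 + a - d + M%:R))).
Proof.
move=> a0 b0 c0 d0 s0; elim: M => [|M IH].
  rewrite !vwp_term0; field.
  by do ?[apply/andP; split]; apply: lt0r_neq0; lra.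
rewrite !vwp_termS IH /vwp_ratio -[M.+1%:R]natr1.
have M0 : 0 <= M%:R :> R by [].
move: (M%:R) M0 => m m0; field.
by do ?[apply/andP; split]; apply: lt0r_neq0; lra.
Qed.

(* Zeilberger's method: the right-hand side is the antidifference in [M]. *)
Lemma vwp_contiguous (R : realType) (a b c d : R) (M : nat) :
  0 < a -> 0 <= b -> 0 <= c -> 0 <= d -> 0 < 1 + a - b - c - d ->
  \sum_(j < M) vwp_term a b c d j
  - vwp_shift a b c d * \sum_(j < M) vwp_term (a + 1) b c d j
  = - (M%:R * (1 + 2 * a - b - c - d + M%:R) /
       ((a + 2 * M%:R) * (1 + a - b - c - d))) * vwp_term a b c d M.
Proof.
move=> a0 b0 c0 d0 s0; elim: M => [|M IH].
  by rewrite !big_ord0 !mul0r oppr0 mul0r mulr0 subr0.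
rewrite !big_ord_recr /= mulrDr opprD addrACA {}IH vwp_term_succ //.
rewrite vwp_termS /vwp_ratio /vwp_shift -[M.+1%:R]natr1.
have M0 : 0 <= M%:R :> R by [].
move: (M%:R) M0 (vwp_term a b c d M) => m m0 u; field.
by do ?[apply/andP; split]; apply: lt0r_neq0; lra.
Qed.

Lemma vwp_ratio_gt0 (R : realType) (a b c d : R) (j : nat) :
  0 < a -> 0 < b -> 0 < c -> 0 < d -> 0 < 1 + a - b - c - d ->
  0 < vwp_ratio a b c d j.
Proof.
move=> a0 b0 c0 d0 s0; rewrite /vwp_ratio.
have j0 : 0 <= j%:R :> R by [].
by do ?[apply: mulr_gt0|rewrite invr_gt0]; lra.
Qed.

Lemma vwp_term_gt0 (R : realType) (a b c d : R) (M : nat) :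
  0 < a -> 0 < b -> 0 < c -> 0 < d -> 0 < 1 + a - b - c - d ->
  0 < vwp_term a b c d M.
Proof. by move=> *; apply: prodr_gt0 => i _; exact: vwp_ratio_gt0. Qed.

Lemma vwp_ratio_succ_le (R : realType) (a b c d : R) (j : nat) :
  1 <= a -> 0 < b <= 1 -> 0 < c -> 0 < d <= 1 -> 0 < 1 + a - b - c - d ->
  vwp_ratio (a + 1) b c d j <= vwp_ratio a b c d j.
Proof.
move=> a1 /andP[b0 b1] c0 /andP[d0 d1] s0; rewrite /vwp_ratio.
have: 0 <= j%:R :> R by [].
move: (j%:R) => y y0.
have first_factor : (a + 1 + 2 * y + 2) / (a + 1 + 2 * y)
    <= (a + 2 * y + 2) / (a + 2 * y).
  rewrite ler_pdivrMr; last lra.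
  rewrite [leRHS]mulrAC ler_pdivlMr; last lra.
  lra.
apply: ler_pM => //.
- by rewrite divr_ge0//; lra.
- by do ?[apply: mulr_ge0|rewrite invr_ge0]; lra.
have b'0 : 0 < 1 + a - b + y by lra.
have c'0 : 0 < 1 + a - c + y by lra.
have d'0 : 0 < 1 + a - d + y by lra.
have bcd : 0 <= (b + y) * (c + y) * (d + y).
  by do ?apply: mulr_ge0; lra.
rewrite ler_pdivrMr; last by do ?apply: mulr_gt0; lra.
rewrite [leRHS]mulrAC ler_pdivlMr; last by do ?apply: mulr_gt0; lra.
set p := 1 + a - b + y in b'0 *; set q := 1 + a - d + y in d'0 *.
set r := 1 + a - c + y in c'0 *.
rewrite (_ : 1 + (a + 1) - b + y = p + 1); last by rewrite /p; ring.
rewrite (_ : 1 + (a + 1) - d + y = q + 1); last by rewrite /q; ring.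
rewrite (_ : 1 + (a + 1) - c + y = r + 1); last by rewrite /r; ring.
rewrite (_ : _ * (p * r * q * (1 + y)) = ((b + y) * (c + y) * (d + y)) *
  ((1 + y) * ((a + 1 + y) * (p * q) * r))); last by ring.
rewrite (_ : _ * (_ * (1 + y)) = ((b + y) * (c + y) * (d + y)) *
  ((1 + y) * ((a + y) * ((p + 1) * (q + 1)) * (r + 1)))); last by ring.
apply: ler_wpM2l => //; apply: ler_wpM2l; first lra.
(* As b and d lie in (0, 1], both p and q lie between a + y and a + y + 1; this gives (a + y + 1) p
   q <= (a + y) (p + 1) (q + 1). *)
have qa : a + y <= q by rewrite /q; lra.
have pa : p <= a + y + 1 by rewrite /p; lra.
have yq : 0 <= (a + y - 1) * (q - 1) by apply: mulr_ge0; lra.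
apply: ler_pM; [|lra| |lra].
  by do ?apply: mulr_ge0; lra.
have qa1 : q <= a + y + 1 by rewrite /q; lra.
have : 0 <= p * (a + y + 1 - q) by apply: mulr_ge0; lra.
by clearbody p q; lra.
Qed.

(** Decay of the first ratio in n is what makes every term but the leading one disappear. With A = a
    + n, the bound b <= 1 + A - c comes from the positivity of 1 + a - b - c - d, as c may exceed
    1. *)
Lemma vwp_ratio0_le (R : realType) (a b c d : R) (n : nat) :
  1 <= a -> 0 < b <= 1 -> 0 < c -> 0 < d <= 1 -> 0 < 1 + a - b - c - d ->
  vwp_ratio (a + n%:R) b c d 0 <= (3 * c * d) / n.+1%:R.
Proof.
move=> a1 /andP[b0 b1] c0 /andP[d0 d1] s0; rewrite /vwp_ratio -[n.+1%:R]natr1.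
have n0 : 0 <= n%:R :> R by [].
set A := a + n%:R; have An : n%:R + 1 <= A by rewrite /A; lra.
have sA : 0 < 1 + A - b - c - d by rewrite /A; lra.
rewrite mulr0 !addr0 mulr1.
rewrite [leLHS](_ : _ = (b * ((A + 2) * (c * d))) /
    ((1 + A - c) * (1 + A - b) * (1 + A - d))); last first.
  by field; do ?[apply/andP; split]; apply: lt0r_neq0; lra.
rewrite ler_pdivrMr; last by do ?apply: mulr_gt0; lra.
rewrite [leRHS]mulrAC ler_pdivlMr; last lra.
rewrite (_ : 3 * c * d * _ = (1 + A - c) *
  (3 * (1 + A - b) * (1 + A - d) * (c * d))); last by ring.
rewrite -[leLHS]mulrA; apply: ler_pM; [lra| |lra|].
  by do ?apply: mulr_ge0; lra.
rewrite mulrAC; apply: ler_wpM2r; first by apply: mulr_ge0; lra.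
apply: (@le_trans _ _ ((3 * (1 + A - b)) * (n%:R + 1))).
  by apply: ler_wpM2r; lra.
by apply: ler_wpM2l; lra.
Qed.

(** Later ratios are compared by monotonicity in a; the first is kept as a factor, since it carries
    the decay in n. *)
Lemma vwp_term_shift_le (R : realType) (a b c d : R) (n j : nat) :
  1 <= a -> 0 < b <= 1 -> 0 < c -> 0 < d <= 1 -> 0 < 1 + a - b - c - d ->
  vwp_term (a + n%:R) b c d j.+1 <=
  vwp_ratio (a + n%:R) b c d 0 / vwp_ratio a b c d 0 * vwp_term a b c d j.+1.
Proof.
move=> a1 b01 c0 d01 s0; have [b0 b1] := andP b01; have [d0 d1] := andP d01.
have ratio_le i : vwp_ratio (a + n%:R) b c d i <= vwp_ratio a b c d i.
  elim: n => [|n IH]; first by rewrite addr0.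
  rewrite -[n.+1%:R]natr1 addrA (le_trans _ IH)// vwp_ratio_succ_le//.
    by rewrite (le_trans a1)// lerDl.
  by have := ler0n R n; lra.
have r0 : 0 < vwp_ratio a b c d 0 by apply: vwp_ratio_gt0 => //; lra.
have n0 := ler0n R n.
rewrite /vwp_term !big_ord_recl mulrA divfK ?lt0r_neq0//.
apply: ler_wpM2l; first by apply/ltW/vwp_ratio_gt0 => //; lra.
apply: ler_prod => i _; rewrite ratio_le andbT.
by apply/ltW/vwp_ratio_gt0 => //; lra.
Qed.

Lemma cvgn_vwp_shift (R : realType) (a b c d : R) (n : nat) :
  1 <= a -> 0 < b <= 1 -> 0 < c -> 0 < d <= 1 -> 0 < 1 + a - b - c - d ->
  cvgn (series (vwp_term a b c d)) ->
  cvgn (series (vwp_term (a + n%:R) b c d)).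
Proof.
move=> a1 b01 c0 d01 s0; have [b0 b1] := andP b01; have [d0 d1] := andP d01.
have n0 := ler0n R n.
move=> cv; pose K := vwp_ratio (a + n%:R) b c d 0 / vwp_ratio a b c d 0.
have K0 : 0 <= K by rewrite divr_ge0// ltW// vwp_ratio_gt0//; lra.
have T0 j : 0 <= vwp_term a b c d j by apply/ltW/vwp_term_gt0 => //; lra.
apply: (@series_le_cvg _ _ (fun j => (1 + K) * vwp_term a b c d j)).
- by move=> j; apply/ltW/vwp_term_gt0 => //; lra.
- by move=> j; rewrite mulr_ge0// addr_ge0.
- case=> [|j]; first by rewrite !vwp_term0 mulr1 lerDl.
  rewrite (le_trans (vwp_term_shift_le n j a1 b01 c0 d01 s0))//.
  by rewrite -/K ler_wpM2r// lerDr.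
exact: (@is_cvg_seriesZ _ _ (1 + K) cv).
Qed.

(* As [a] tends to infinity only the leading term of the series survives, so
   iterating the contiguity relation turns the sum into an infinite product. *)
Lemma cvg_vwp_prod (R : realType) (a b c d : R) :
  1 <= a -> 0 < b <= 1 -> 0 < c -> 0 < d <= 1 -> 0 < 1 + a - b - c - d ->
  cvgn (series (vwp_term a b c d)) ->
  (M%:R * vwp_term a b c d M) @[M --> \oo] --> (0 : R) ->
  (\prod_(n < N) vwp_shift (a + n%:R) b c d) @[N --> \oo] -->
  limn (series (vwp_term a b c d)).
Proof.
move=> a1 b01 c0 d01 s0; have [b0 b1] := andP b01; have [d0 d1] := andP d01.
move=> cv cvM.
have T0 n j : 0 < vwp_term (a + n%:R) b c d j.
  by have n0 := ler0n R n; apply: vwp_term_gt0 => //; lra.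
pose S n := limn (series (vwp_term (a + n%:R) b c d)).
have cvS n : cvgn (series (vwp_term (a + n%:R) b c d)).
  exact: cvgn_vwp_shift.
have r0 n : 0 < vwp_ratio (a + n%:R) b c d 0.
  by have n0 := ler0n R n; apply: vwp_ratio_gt0 => //; lra.
have ra0 : 0 < vwp_ratio a b c d 0 by have := r0 0%N; rewrite addr0.
have cvMn n : (M%:R * vwp_term (a + n%:R) b c d M) @[M --> \oo] --> (0 : R).
  apply: (@squeeze_cvgr _ _ _ _ (fun=> 0)
      (fun M => vwp_ratio (a + n%:R) b c d 0 / vwp_ratio a b c d 0 *
         (M%:R * vwp_term a b c d M))).
  - apply: nearW => -[|j]; first by rewrite !mul0r mulr0 lexx.
    rewrite mulr_ge0//=; last exact: ltW.
    by rewrite mulrCA ler_wpM2l// vwp_term_shift_le.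
  - exact: cvg_cst.
  - by rewrite -[X in _ --> X](mulr0 (vwp_ratio (a + n%:R) b c d 0 /
      vwp_ratio a b c d 0)); apply: cvgMr.
have step n : S n = vwp_shift (a + n%:R) b c d * S n.+1.
  have n0 := ler0n R n.
  apply/eqP; rewrite -subr_eq0; apply/eqP.
  have lhs : (\sum_(j < M) vwp_term (a + n%:R) b c d j
      - vwp_shift (a + n%:R) b c d *
        \sum_(j < M) vwp_term (a + n%:R + 1) b c d j) @[M --> \oo]
      --> S n - vwp_shift (a + n%:R) b c d * S n.+1.
    have := cvS n.+1; rewrite /S -[n.+1%:R]natr1 addrA => cvn1.
    have := cvS n; rewrite seriesEord; move: cvn1; rewrite seriesEord.
    by move=> cvn1 cvn; apply: cvgB => //; apply: cvgMr.
  rewrite -(cvg_lim _ lhs)//; apply/cvg_lim => //.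
  (* This dominates the boundary term of the contiguity relation, because (1 + 2 A - b - c - d + m)
     / (A + 2 m) <= 2 A + 2 for A >= 1. *)
  have lim0 : (- (1 + 2 * (a + n%:R) + 1) / (1 + (a + n%:R) - b - c - d) *
      (M%:R * vwp_term (a + n%:R) b c d M)) @[M --> \oo] --> (0 : R).
    by rewrite -[X in _ --> X](mulr0 (- (1 + 2 * (a + n%:R) + 1) /
      (1 + (a + n%:R) - b - c - d))); apply: cvgMr.
  apply: (squeeze_cvgr _ lim0 (cvg_cst 0)).
  apply: nearW => M; rewrite vwp_contiguous//; [|lra..].
  have M0 := ler0n R M; have := ltW (T0 n M).
  have A1 : 1 <= a + n%:R by lra.
  have sA : 0 < 1 + (a + n%:R) - b - c - d by lra.
  move: (a + n%:R) A1 sA (M%:R) M0 (vwp_term _ _ _ _ _) => A A1 sA m m0 u u0.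
  have w0 : 0 <= m * u / (1 + A - b - c - d).
    by rewrite divr_ge0 ?mulr_ge0//; lra.
  rewrite [X in _ <= X <= _](_ : _ = - ((1 + 2 * A - b - c - d + m) /
      (A + 2 * m) * (m * u / (1 + A - b - c - d)))); last first.
    by field; apply/andP; split; apply: lt0r_neq0; lra.
  rewrite [X in X <= _ <= _](_ : _ = - ((1 + 2 * A + 1) *
      (m * u / (1 + A - b - c - d)))); last first.
    by field; apply: lt0r_neq0; lra.
  have q0 : 0 <= (1 + 2 * A - b - c - d + m) / (A + 2 * m).
    by rewrite divr_ge0; lra.
  rewrite oppr_le0 lerN2 mulr_ge0 // andbT.
  rewrite ler_wpM2r// ler_pdivrMr; last lra.
  have : 0 <= (2 * A + 1) * (A + 2 * m - 1) by apply: mulr_ge0; lra.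
  lra.
have prodS N : \prod_(n < N) vwp_shift (a + n%:R) b c d * S N = S 0%N.
  elim: N => [|N IH]; first by rewrite big_ord0 mul1r.
  by rewrite big_ord_recr /= -mulrA -step.
have S_ge1 n : 1 <= S n.
  rewrite /S (le_trans _ (nondecreasing_cvgn_le _ (cvS n) 1%N))//.
    by rewrite seriesEord /= big_ord1 vwp_term0.
  by apply: nondecreasing_series => j _ _; exact: ltW.
have S_le n :
    S n <= 1 + vwp_ratio (a + n%:R) b c d 0 / vwp_ratio a b c d 0 * S 0%N.
  apply: limr_le => //; apply: nearW => -[|N].
    rewrite seriesEord /= big_ord0 addr_ge0// mulr_ge0 ?divr_ge0// ltW//.
    exact: lt_le_trans (S_ge1 _).
  rewrite seriesEord /= big_ord_recl vwp_term0 lerD2l.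
  apply: (@le_trans _ _ (vwp_ratio (a + n%:R) b c d 0 / vwp_ratio a b c d 0 *
      \sum_(i < N) vwp_term a b c d i.+1)).
    by rewrite mulr_sumr; apply: ler_sum => i _; exact: vwp_term_shift_le.
  apply: ler_wpM2l; first by rewrite divr_ge0// ltW.
  have le_S : series (vwp_term (a + 0%:R) b c d) N.+1 <= S 0%N.
    apply: nondecreasing_cvgn_le (cvS 0%N) _.
    by apply: nondecreasing_series => j _ _; exact: ltW.
  apply: (le_trans _ le_S); rewrite addr0 seriesEord /= big_ord_recl lerDr.
  by have := T0 0%N 0%N; rewrite addr0 => /ltW.
have S_cvg : S @ \oo --> (1 : R).
  pose K := 3 * c * d / vwp_ratio a b c d 0 * S 0%N.
  have upper : (1 + K * harmonic n) @[n --> \oo] --> (1 : R).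
    rewrite -[X in _ --> X](addr0 1); apply: cvgD; first exact: cvg_cst.
    rewrite -[X in _ --> X](mulr0 K); apply: cvgMr; exact: cvg_harmonic.
  apply: (@squeeze_cvgr _ _ _ _ (fun=> 1) (fun n => 1 + K * harmonic n)) => //;
    last exact: cvg_cst.
  apply: nearW => n; rewrite S_ge1 /= (le_trans (S_le n))// lerD2l.
  rewrite [leRHS](_ : _ = 3 * c * d / n.+1%:R / vwp_ratio a b c d 0 * S 0%N);
    last by rewrite /K /harmonic /=; ring.
  rewrite ler_wpM2r//; first exact: le_trans (S_ge1 _).
  by rewrite ler_wpM2r ?invr_ge0 ?(ltW ra0)//; exact: vwp_ratio0_le.
have -> : series (vwp_term a b c d) = series (vwp_term (a + 0%:R) b c d).
  by rewrite addr0.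
rewrite -/(S 0%N).
have -> : (fun N => \prod_(n < N) vwp_shift (a + n%:R) b c d) =
    (fun N => S 0%N / S N).
  apply/funext => N; rewrite -(prodS N) mulfK// gt_eqF//.
  exact: lt_le_trans (S_ge1 _).
rewrite -[X in _ --> X]divr1; apply: cvgM; first exact: cvg_cst.
exact: cvgV.
Qed.

(** * Sums over odd numbers *)

Definition oddr (R : realType) (j : nat) : R := j.*2.+1%:R.

Lemma oddrE (R : realType) (j : nat) : oddr R j = 2 * j%:R + 1.
Proof. by rewrite /oddr -[_.+1%:R]natr1 -muln2 natrM mulrC. Qed.

Lemma oddr_ge1 (R : realType) (j : nat) : 1 <= oddr R j.
Proof. by rewrite /oddr ler1n. Qed.

Definition odd_prod (R : realType) (x : R) (J : nat) : R :=
  \prod_(i < J) ((oddr R i + x) / (oddr R i - x)).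

Definition odd_term (R : realType) (x : R) (J : nat) : R :=
  odd_prod x J / (oddr R J * (oddr R J - x)).

Lemma odd_prodS (R : realType) (x : R) (J : nat) :
  odd_prod x J.+1 = odd_prod x J * ((oddr R J + x) / (oddr R J - x)).
Proof. by rewrite /odd_prod big_ord_recr. Qed.

Lemma odd_prod_gt0 (R : realType) (x : R) (J : nat) :
  0 <= x < 1 -> 0 < odd_prod x J.
Proof.
move=> /andP[x0 x1]; apply: prodr_gt0 => i _.
by have := oddr_ge1 R i => oi; apply: divr_gt0; lra.
Qed.

Lemma odd_term_gt0 (R : realType) (x : R) (J : nat) :
  0 <= x < 1 -> 0 < odd_term x J.
Proof.
move=> x01; have /andP[x0 x1] := x01; have := oddr_ge1 R J => oi.
by apply: divr_gt0; [exact: odd_prod_gt0|apply: mulr_gt0; lra].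
Qed.

Lemma odd_term0 (R : realType) (J : nat) : odd_term 0 J = oddr R J ^- 2.
Proof.
rewrite /odd_term /odd_prod big1 ?subr0 ?mul1r ?expr2// => j _.
rewrite addr0 subr0 divff//; have := oddr_ge1 R j => o1.
by apply: lt0r_neq0; lra.
Qed.

(** The true order of growth is J^x. The induction step is o (o + x)^2 <= (o + 2) (o - x)^2, whose
    difference (2 - 4 x) o^2 - 4 x o + 2 x^2 is nonnegative for x <= 1/4 and o >= 1. *)
Lemma odd_prod_sqr_le (R : realType) (x : R) (J : nat) :
  0 <= x <= 1 / 4 -> odd_prod x J ^+ 2 <= oddr R J.
Proof.
move=> /andP[x0 x4]; elim: J => [|J IH].
  by rewrite /odd_prod big_ord0 expr1n oddr_ge1.
have oJ := oddr_ge1 R J.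
rewrite odd_prodS exprMn expr_div_n mulrA ler_pdivrMr; last first.
  by rewrite exprn_gt0//; lra.
have -> : oddr R J.+1 = oddr R J + 2 by rewrite !oddrE -[J.+1%:R]natr1; ring.
move: (oddr R J) oJ IH => y y1 IH.
apply: (@le_trans _ _ (y * (y + x) ^+ 2)).
  by rewrite ler_wpM2r// exprn_ge0//; lra.
have : 0 <= y * y * (1 - 4 * x) by do ?apply: mulr_ge0; lra.
have : 0 <= y * (1 - 4 * x) by apply: mulr_ge0; lra.
have : 0 <= y * (y - 1) by apply: mulr_ge0; lra.
have : 0 <= x * x by apply: mulr_ge0.
rewrite !expr2; lra.
Qed.

(** The difference on the right is exactly [odd_term x J] times 2 ((1 - x) o - x) / (o + 2); this
    factor is least at o = 1, x = 1/4, where it equals 1/3, hence the constant 3. *)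
Lemma odd_term_telescope (R : realType) (x : R) (J : nat) :
  0 <= x <= 1 / 4 ->
  odd_term x J <= 3 * (odd_prod x J / oddr R J - odd_prod x J.+1 / oddr R J.+1).
Proof.
move=> /andP[x0 x4]; have oJ := oddr_ge1 R J.
have H0 : 0 < odd_prod x J by apply: odd_prod_gt0; rewrite x0; lra.
rewrite odd_prodS /odd_term.
have -> : oddr R J.+1 = oddr R J + 2 by rewrite !oddrE -[J.+1%:R]natr1; ring.
move: (oddr R J) oJ (odd_prod x J) H0 => y y1 h h0.
rewrite [leRHS](_ : _ = h / (y * (y - x)) *
    (6 * ((1 - x) * y - x) / (y + 2))); last first.
  by field; do ?[apply/andP; split]; apply: lt0r_neq0; lra.
rewrite ler_pMr; last by apply: divr_gt0 => //; apply: mulr_gt0; lra.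
rewrite ler_pdivlMr; last lra.
have : 0 <= (1 / 4 - x) * y by apply: mulr_ge0; lra.
lra.
Qed.

Lemma series_odd_term_le (R : realType) (x : R) (n : nat) :
  0 <= x <= 1 / 4 -> series (odd_term x) n <= 3.
Proof.
move=> x04; have /andP[x0 x4] := x04.
have x01 : 0 <= x < 1 by rewrite x0; lra.
have : series (odd_term x) n <= 3 * (1 - odd_prod x n / oddr R n).
  rewrite seriesEord /=; elim: n => [|n IH].
    by rewrite big_ord0 /odd_prod big_ord0 /oddr divr1 subrr mulr0.
  rewrite big_ord_recr /=.
  have := odd_term_telescope n x04.
  move: (odd_term x n) (\sum_(i < n) odd_term x i) IH => u s.
  move: (odd_prod x n / oddr R n) (odd_prod x n.+1 / oddr R n.+1) => v w; lra.
have : 0 <= odd_prod x n / oddr R n.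
  by rewrite divr_ge0 ?ler0n// ltW// odd_prod_gt0.
by move: (odd_prod x n / oddr R n) (series _ _) => v s; lra.
Qed.

Lemma cvgn_odd_term (R : realType) (x : R) :
  0 <= x <= 1 / 4 -> cvgn (series (odd_term x)).
Proof.
move=> x04; have /andP[x0 x4] := x04.
apply: nondecreasing_is_cvgn.
  apply: nondecreasing_series => j _ _; apply/ltW/odd_term_gt0.
  by rewrite x0; lra.
by exists 3 => _ [n _ <-]; exact: series_odd_term_le.
Qed.

(** With these parameters the ratio of consecutive terms collapses to o_j (o_j + x) / (o_(j+1)
    (o_(j+1) - x)); the normalisation 1 - x is the inverse of [odd_term x 0]. *)
Lemma vwp_odd_term (R : realType) (x : R) (j : nat) : 0 <= x < 1 ->
  vwp_term 1 (1 / 2) ((1 + x) / 2) (1 / 2) j = (1 - x) * odd_term x j.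
Proof.
move=> /andP[x0 x1]; elim: j => [|j IH].
  rewrite vwp_term0 /odd_term /odd_prod big_ord0 oddrE mulr0 add0r; field.
  by apply: lt0r_neq0; lra.
rewrite vwp_termS IH /odd_term odd_prodS /vwp_ratio !oddrE -[j.+1%:R]natr1.
have j0 := ler0n R j; move: (j%:R) j0 (odd_prod x j) => y y0 h; field.
by do ?[apply/andP; split]; apply: lt0r_neq0; lra.
Qed.

Definition odd_sum (R : realType) (x : R) : R := limn (series (odd_term x)).

Lemma odd_sum_gt0 (R : realType) (x : R) : 0 <= x <= 1 / 4 -> 0 < odd_sum x.
Proof.
move=> x04; have /andP[x0 x4] := x04.
have x01 : 0 <= x < 1 by rewrite x0; lra.
apply: (@lt_le_trans _ _ (series (odd_term x) 1)).
  by rewrite seriesEord /= big_ord1 odd_term_gt0.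
apply: nondecreasing_cvgn_le; last exact: cvgn_odd_term.
by apply: nondecreasing_series => j _ _; exact/ltW/odd_term_gt0.
Qed.

Lemma cvg_odd_prod_ratio (R : realType) (x : R) : 0 <= x <= 1 / 4 ->
  odd_prod x n / oddr R n @[n --> \oo] --> (0 : R).
Proof.
move=> x04; have /andP[x0 x4] := x04.
have x01 : 0 <= x < 1 by rewrite x0; lra.
apply: (@squeeze_cvgr _ _ _ _ (fun=> 0) (fun n => Num.sqrt (harmonic n))).
- apply: nearW => n; have o1 := oddr_ge1 R n.
  have h0 : 0 <= odd_prod x n / oddr R n.
    by rewrite divr_ge0 ?ler0n// ltW// odd_prod_gt0.
  rewrite h0 /= -[leLHS](ger0_norm h0) -sqrtr_sqr.
  rewrite ler_wsqrtr// expr_div_n ler_pdivrMr; last by rewrite exprn_gt0//; lra.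
  have ho : 1 <= harmonic n * oddr R n.
    rewrite /harmonic /= mulrC ler_pdivlMr ?ltr0n// mul1r /oddr ler_nat ltnS.
    by rewrite -addnn leq_addr.
  apply: (le_trans (odd_prod_sqr_le n x04)); by rewrite expr2 mulrA ler_peMl//.
- exact: cvg_cst.
- rewrite -[X in _ --> X]sqrtr0.
  exact: (@continuous_cvg _ R R _ _ harmonic Num.sqrt 0
    (@sqrt_continuous R 0) cvg_harmonic).
Qed.

(** * The infinite product *)

Definition wallis_factor (R : realType) (x : R) (i : nat) : R :=
  (1 - x / (i.*2.+2)%:R) / (1 - x / oddr R i).

(** Up to a constant, the denominator of [vwp_shift] contains (o_n - x) (o_(n+1) - x); realigning
    these neighbouring factors into a square leaves the boundary factor (1 - x) / (o_N - x). All
    x-free factors are absorbed in the product at x = 0. *)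
Lemma vwp_shift_wallis (R : realType) (x : R) (N : nat) : 0 <= x < 1 ->
  (\prod_(n < N) vwp_shift (1 + n%:R) (1 / 2) ((1 + x) / 2) (1 / 2)) *
    (oddr R N - x) =
  (\prod_(n < N) vwp_shift (1 + n%:R) (1 / 2) ((1 + 0) / 2) (1 / 2)) *
  ((1 - x) * oddr R N * (\prod_(i < N) wallis_factor x i) ^+ 2).
Proof.
move=> /andP[x0 x1]; elim: N => [|N IH].
  by rewrite !big_ord0 /oddr expr1n !mul1r !mulr1.
have o1 := oddr_ge1 R N.
rewrite !big_ord_recr /=.
move: IH; rewrite exprMn.
set Px := \prod_(n < N) _; set P0 := \prod_(n < N) _; set g := _ ^+ 2.
move=> IH.
apply: (@mulIf _ (oddr R N - x)); first by apply: lt0r_neq0; lra.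
rewrite -[LHS]mulrA [_ * (oddr R N - x)]mulrC mulrA.
rewrite (_ : Px * _ * _ * _ = (Px * (oddr R N - x)) * (vwp_shift (1 + N%:R)
  (1 / 2) ((1 + x) / 2) (1 / 2) * (oddr R N.+1 - x))); last by ring.
rewrite IH /vwp_shift /wallis_factor !oddrE -[N.+1%:R]natr1.
rewrite -[N.*2.+2%:R]natr1 -[N.*2.+1%:R]natr1 -muln2 natrM.
have N0 := ler0n R N; move: (N%:R) N0 Px P0 g {IH o1} => y y0 Px P0 g; field.
by do ?[apply/andP; split]; apply: lt0r_neq0; lra.
Qed.

Lemma cvg_vwp_odd (R : realType) (x : R) : 0 <= x <= 1 / 4 ->
  (\prod_(n < N) vwp_shift (1 + n%:R) (1 / 2) ((1 + x) / 2) (1 / 2))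
    @[N --> \oo] --> (1 - x) * odd_sum x.
Proof.
move=> x04; have /andP[x0 x4] := x04.
have x01 : 0 <= x < 1 by rewrite x0; lra.
have eT : vwp_term 1 (1 / 2) ((1 + x) / 2) (1 / 2) = (1 - x) *: odd_term x.
  by apply/funext => j; exact: vwp_odd_term.
have <- : limn (series (vwp_term 1 (1 / 2) ((1 + x) / 2) (1 / 2))) =
    (1 - x) * odd_sum x.
  by rewrite eT lim_seriesZ//; exact: cvgn_odd_term.
apply: cvg_vwp_prod; [lra|lra|lra|lra|lra| |].
  by rewrite eT; apply: is_cvg_seriesZ; exact: cvgn_odd_term.
apply: (@squeeze_cvgr _ _ _ _ (fun=> 0) (fun n => odd_prod x n / oddr R n)).
- apply: nearW => M; rewrite vwp_odd_term// /odd_term.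
  have := odd_prod_gt0 M x01; rewrite oddrE.
  have M0 := ler0n R M; move: (M%:R) M0 (odd_prod x M) => y y0 h h0.
  have h'0 : 0 <= h / (2 * y + 1) by rewrite divr_ge0//; lra.
  rewrite [X in _ <= X <= _](_ : _ = h / (2 * y + 1) *
      (y * (1 - x) / (2 * y + 1 - x))); last first.
    by field; apply/andP; split; apply: lt0r_neq0; lra.
  have xy : 0 <= x * y by rewrite mulr_ge0.
  rewrite mulr_ge0//= ?ler_piMr// ?ler_pdivrMr ?divr_ge0 ?mulr_ge0//; lra.
- exact: cvg_cst.
- exact: cvg_odd_prod_ratio.
Qed.

Lemma cvg_wallis_sqr (R : realType) (x : R) : 0 <= x <= 1 / 4 ->
  (\prod_(i < N) wallis_factor x i) ^+ 2 @[N --> \oo] -->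
  odd_sum x / odd_sum (0 : R).
Proof.
move=> x04; have /andP[x0 x4] := x04.
have x01 : 0 <= x < 1 by rewrite x0; lra.
have z04 : 0 <= (0 : R) <= 1 / 4 by apply/andP; split; lra.
have cx := cvg_vwp_odd x04; have c0 := cvg_vwp_odd z04.
have F0 := odd_sum_gt0 z04.
have co : (1 - x / oddr R N) @[N --> \oo] --> (1 : R).
  rewrite -[X in _ --> X](subr0 1); apply: cvgB; first exact: cvg_cst.
  rewrite -[X in _ --> X](mulr0 x); apply: cvgMr.
  apply: (@squeeze_cvgr _ _ _ _ (fun=> 0) harmonic).
  - apply: nearW => n; rewrite invr_ge0 ler0n /= /harmonic /=.
    by rewrite lef_pV2 ?posrE ?ltr0n// /oddr ler_nat ltnS -addnn leq_addr.
  - exact: cvg_cst.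
  - exact: cvg_harmonic.
have -> : (fun N => (\prod_(i < N) wallis_factor x i) ^+ 2) = (fun N =>
    (\prod_(n < N) vwp_shift (1 + n%:R) (1 / 2) ((1 + x) / 2) (1 / 2)) *
    (\prod_(n < N) vwp_shift (1 + n%:R) (1 / 2) ((1 + 0) / 2) (1 / 2))^-1 *
    (1 - x / oddr R N) * (1 - x)^-1).
  apply/funext => N; have o1 := oddr_ge1 R N.
  have P0 : 0 < \prod_(n < N)
      vwp_shift (1 + n%:R) (1 / 2) ((1 + 0) / 2) (1 / 2) :> R.
    apply: prodr_gt0 => n _; have n0 := ler0n R n; rewrite /vwp_shift.
    by do ?[apply: mulr_gt0|rewrite invr_gt0]; lra.
  move: (vwp_shift_wallis N x01) P0.
  set Px := \prod_(n < N) _; set P0 := \prod_(n < N) _.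
  set g := _ ^+ 2 => E P0_gt0.
  have -> : Px = P0 * ((1 - x) * oddr R N * g) / (oddr R N - x).
    by rewrite -E mulfK//; apply: lt0r_neq0; lra.
  by field; do ?[apply/andP; split]; apply: lt0r_neq0; lra.
rewrite [X in _ --> X](_ : _ = (1 - x) * odd_sum x * ((1 - 0) * odd_sum 0)^-1
    * 1 * (1 - x)^-1); last first.
  by field; apply/andP; split; apply: lt0r_neq0; lra.
apply: cvgMl; apply: cvgM => //; apply: cvgM => //.
by apply: cvgV => //; apply: lt0r_neq0; rewrite subr0 mul1r.
Qed.

(** * Taylor expansions *)

Definition ln_rest (R : realType) (K : nat) (y : R) : R :=
  - ln (1 - y) - \sum_(1 <= i < K.+1) y ^+ i / i%:R.

Lemma is_derive_ln_rest (R : realType) (K : nat) (y : R) :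
  y < 1 -> is_derive y 1 (@ln_rest R K) (y ^+ K / (1 - y)).
Proof.
move=> y1; elim: K => [|K IH].
  have -> : @ln_rest R 0 = - (fun z => ln (1 - z)).
    by apply/funext => z; rewrite /ln_rest big_geq// subr0.
  have d1 : is_derive (y : R) 1 (fun z : R => 1 - z) (0 - 1).
    by apply: is_deriveB.
  have d2 := @is_derive1_ln R (1 - y) ltac:(by rewrite subr_gt0).
  have d3 := is_deriveN
    (@is_derive1_comp R (@ln R) (fun z : R => 1 - z) y _ _ d2 d1).
  apply: (is_derive_eq d3).
  by rewrite expr0 mul1r sub0r mulrN1 opprK.
have -> : @ln_rest R K.+1 =
    @ln_rest R K - (K.+1%:R^-1 *: (@GRing.exp R ^~ K.+1)).
  apply/funext => z; rewrite /ln_rest big_nat_recr//= opprD addrA.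
  by congr (_ - _); rewrite mulrC.
have d1 : is_derive y 1 (@GRing.exp R ^~ K.+1) ((K.+1%:R * y ^+ K) *: 1).
  by have := @is_deriveX R R id K.+1 y 1 1 (is_derive_id _ _); rewrite fctE.
have d3 := is_deriveB IH (is_deriveZ K.+1%:R^-1 d1).
apply: (is_derive_eq d3).
have K0 : K.+1%:R != 0 :> R by rewrite pnatr_eq0.
have y0 : 1 - y != 0 by rewrite subr_eq0 gt_eqF.
rewrite exprS /GRing.scale /=; move: (K.+1%:R) K0 (y ^+ K) => k K0 u; field.
by rewrite y0 K0.
Qed.

Lemma ln_rest_bounds (R : realType) (K : nat) (y : R) :
  0 <= y <= 1 / 2 -> 0 <= ln_rest K y <= 2 * y ^+ K.+1.
Proof.
move=> /andP[y0 y2].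
have dr (z : R) : z < 1 -> is_derive z 1 (@ln_rest R K) (z ^+ K / (1 - z)).
  exact: is_derive_ln_rest.
have cont : {within `[0, y], continuous (@ln_rest R K)}.
  apply: derivable_within_continuous => z; rewrite in_itv /= => /andP[z0 zy].
  have z1 : z < 1 by lra.
  by have [] := dr z z1.
have drv (z : R) : z \in `]0, y[ ->
    is_derive z 1 (@ln_rest R K) (z ^+ K / (1 - z)).
  by rewrite in_itv /= => /andP[z0 zy]; apply: dr; lra.
have [c] := MVT_segment y0 drv cont.
rewrite in_itv /= => /andP[c0 cy].
have -> : @ln_rest R K 0 = 0.
  rewrite /ln_rest subr0 ln1 oppr0 sub0r big_nat big1 ?oppr0// => i /andP[i0 _].
  by rewrite expr0n eqn0Ngt i0 mul0r.
rewrite !subr0 => ->.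
have cK : c ^+ K <= y ^+ K by rewrite lerXn2r ?nnegrE.
have cK0 : 0 <= c ^+ K by rewrite exprn_ge0.
apply/andP; split; first by do ?[apply: mulr_ge0|rewrite invr_ge0]; lra.
rewrite exprSr mulrA ler_wpM2r// ler_pdivrMr; last lra.
move: (c ^+ K) (y ^+ K) cK cK0 => u v uv u0.
have : 0 <= v * (1 / 2 - c) by apply: mulr_ge0; lra.
lra.
Qed.

Lemma expR_taylor (R : realType) (K : nat) (y : R) : 0 <= y ->
  0 <= expR y - \sum_(m < K.+1) y ^+ m / m`!%:R <= y ^+ K.+1 * expR y.
Proof.
move=> y0.
have cv := @is_cvg_series_exp_coeff R y.
have t0 n : 0 <= exp_coeff y n by rewrite /exp_coeff /= divr_ge0// exprn_ge0.
apply/andP; split.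
  rewrite subr_ge0.
  apply: (le_trans _ (nondecreasing_cvgn_le _ cv K.+1)).
    by rewrite seriesEord.
  by apply: nondecreasing_series => *; exact: t0.
rewrite lerBlDr; apply: limr_le => //.
apply: filterS (nbhs_infty_ge K.+1) => n Kn.
rewrite -(subnKC Kn) seriesEord /= big_split_ord /= addrC lerD2r.
apply: (@le_trans _ _ (y ^+ K.+1 * series (exp_coeff y) (n - K.+1)%N)).
  rewrite seriesEord /= mulr_sumr; apply: ler_sum => i _.
  rewrite /exp_coeff /= exprD -mulrA ler_wpM2l ?exprn_ge0//.
  rewrite ler_wpM2l ?exprn_ge0// lef_pV2 ?posrE ?ltr0n ?fact_gt0// ler_nat.
  by rewrite leq_fact// leq_addl.
rewrite ler_wpM2l ?exprn_ge0//; apply: nondecreasing_cvgn_le cv _.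
by apply: nondecreasing_series => *; exact: t0.
Qed.

(** Coefficient of x^n / n in the logarithm of w_i. Summed over i it gives the Dirichlet eta value 1
    - 2^-n + 3^-n - ...; the pairing makes the summands nonnegative, also at n = 1, where the
    unpaired series converges only conditionally. *)
Definition alt_power_seq (R : realType) (n i : nat) : R :=
  oddr R i ^- n - (i.*2.+2)%:R ^- n.

Definition alt_power_sum (R : realType) (n : nat) : R :=
  limn (series (@alt_power_seq R n)).

Lemma oddr_even (R : realType) (i : nat) : (i.*2.+2)%:R = oddr R i + 1.
Proof. by rewrite /oddr natr1. Qed.

Lemma series_oddr_sqr_le (R : realType) (N : nat) :
  \sum_(i < N) oddr R i ^- 2 <= 3.
Proof.
have z04 : 0 <= (0 : R) <= 1 / 4 by apply/andP; split; lra.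
rewrite (le_trans _ (series_odd_term_le N z04))// seriesEord /=.
by apply: ler_sum => i _; rewrite odd_term0.
Qed.

Lemma alt_power_seq_bounds (R : realType) (n i : nat) : (0 < n)%N ->
  0 <= alt_power_seq R n i <= oddr R i ^- 2.
Proof.
move=> n0; have o1 := oddr_ge1 R i; rewrite /alt_power_seq oddr_even.
move: (oddr R i) o1 => y y1.
have y0 : 0 < y by lra.
have y10 : 0 < y + 1 by lra.
apply/andP; split.
  by rewrite subr_ge0 lef_pV2 ?posrE ?exprn_gt0// lerXn2r// ?nnegrE; lra.
case: n n0 => // -[|n] _.
  rewrite !expr1 (_ : _ - _ = (y * (y + 1))^-1); last first.
    by field; apply/andP; split; apply: lt0r_neq0.
  rewrite lef_pV2 ?posrE ?exprn_gt0 ?mulr_gt0// expr2.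
  by rewrite ler_wpM2l//; lra.
apply: (@le_trans _ _ (y ^- n.+2)).
  by rewrite gerBl invr_ge0 exprn_ge0// ltW.
by rewrite lef_pV2 ?posrE ?exprn_gt0// ler_weXn2l.
Qed.

Lemma cvg_alt_power (R : realType) (n : nat) : (0 < n)%N ->
  cvgn (series (@alt_power_seq R n)).
Proof.
move=> n0; apply: nondecreasing_is_cvgn.
  apply: nondecreasing_series => i _ _.
  by have /andP[] := alt_power_seq_bounds R i n0.
exists 3 => _ [N _ <-]; rewrite seriesEord /=.
apply: le_trans (series_oddr_sqr_le R N); apply: ler_sum => i _.
by have /andP[] := alt_power_seq_bounds R i n0.
Qed.

Lemma alt_power_sum_ge0 (R : realType) (n : nat) : (0 < n)%N ->
  0 <= alt_power_sum R n.
Proof.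
move=> n0; apply: limr_ge; first exact: cvg_alt_power.
apply: nearW => N; rewrite seriesEord /=; apply: sumr_ge0 => i _.
by have /andP[] := alt_power_seq_bounds R i n0.
Qed.

Lemma ln_wallis_factor (R : realType) (K : nat) (x : R) (i : nat) :
  0 <= x <= 1 / 4 ->
  ln (wallis_factor x i) =
  \sum_(1 <= n < K.+1) alt_power_seq R n i * (x ^+ n / n%:R)
  + (ln_rest K (x / oddr R i) - ln_rest K (x / (i.*2.+2)%:R)).
Proof.
move=> /andP[x0 x4]; have o1 := oddr_ge1 R i.
rewrite /wallis_factor oddr_even.
have lt1 y : 1 <= y -> 0 < 1 - x / y.
  by move=> y1; rewrite subr_gt0 ltr_pdivrMr ?mul1r; lra.
rewrite ln_div ?posrE ?lt1 //; last lra.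
rewrite /ln_rest.
have -> : \sum_(1 <= n < K.+1) alt_power_seq R n i * (x ^+ n / n%:R) =
    \sum_(1 <= n < K.+1) (x / oddr R i) ^+ n / n%:R -
    \sum_(1 <= n < K.+1) (x / (oddr R i + 1)) ^+ n / n%:R.
  rewrite -sumrB; apply: eq_bigr => n _.
  by rewrite /alt_power_seq oddr_even !expr_div_n mulrBl; congr (_ - _); ring.
ring.
Qed.

Lemma cvg_sumr (R : realType) (I : Type) (r : seq I) (P : pred I)
    (f : I -> nat -> R) (l : I -> R) :
  (forall i, P i -> f i n @[n --> \oo] --> l i) ->
  \sum_(i <- r | P i) f i n @[n --> \oo] --> \sum_(i <- r | P i) l i.
Proof.
move=> fl; elim: r => [|i r IH].
  by under eq_fun do rewrite big_nil; rewrite big_nil; exact: cvg_cst.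
under eq_fun do rewrite big_cons; rewrite big_cons.
by case: ifPn => // Pi; apply: cvgD => //; exact: fl.
Qed.

(** Twelve is 2 for the square of the product, times 2 from [ln_rest_bounds], times 3 for the sum of
    1 / o_i^2. The condition K > 0 makes (x / o)^(K+1) at most x^(K+1) / o^2, which is summable. *)
Lemma ln_odd_sum (R : realType) (K : nat) (x : R) :
  (0 < K)%N -> 0 <= x <= 1 / 4 ->
  `|ln (odd_sum x / odd_sum 0) -
    2 * \sum_(1 <= n < K.+1) alt_power_sum R n * (x ^+ n / n%:R)|
  <= 12 * x ^+ K.+1.
Proof.
move=> K0 x04; have /andP[x0 x4] := x04.
have x01 : 0 <= x < 1 by rewrite x0; lra.
have z04 : 0 <= (0 : R) <= 1 / 4 by apply/andP; split; lra.
have w0 i : 0 < wallis_factor x i.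
  have o1 := oddr_ge1 R i; rewrite /wallis_factor oddr_even.
  by apply: divr_gt0; rewrite subr_gt0 ltr_pdivrMr ?mul1r; lra.
pose u N := ln ((\prod_(i < N) wallis_factor x i) ^+ 2) -
  2 * \sum_(1 <= n < K.+1) series (@alt_power_seq R n) N * (x ^+ n / n%:R).
have cu : u @ \oo --> ln (odd_sum x / odd_sum 0) -
    2 * \sum_(1 <= n < K.+1) alt_power_sum R n * (x ^+ n / n%:R).
  apply: cvgB.
    apply: (@continuous_cvg _ R R _ _ _ (@ln R)).
      by apply: continuous_ln; apply: divr_gt0; exact: odd_sum_gt0.
    exact: cvg_wallis_sqr.
  apply: cvgMr; rewrite big_nat; under eq_fun do rewrite big_nat.
  apply: cvg_sumr => n /andP[n0 _]; apply: cvgMl; exact: cvg_alt_power.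
have cnu : `|u N| @[N --> \oo] --> `|ln (odd_sum x / odd_sum 0) -
    2 * \sum_(1 <= n < K.+1) alt_power_sum R n * (x ^+ n / n%:R)|.
  exact: cvg_norm.
rewrite -(cvg_lim _ cnu)//; apply: limr_le; first exact: cvgP cnu.
apply: nearW => N; rewrite /u.
have -> : ln ((\prod_(i < N) wallis_factor x i) ^+ 2) =
    2 * \sum_(i < N) ln (wallis_factor x i).
  rewrite lnXn; last by apply: prodr_gt0.
  rewrite -[LHS]mulr_natl; congr (_ * _).
  elim: N => [|N IH]; first by rewrite !big_ord0 ln1.
  by rewrite !big_ord_recr /= lnM ?IH// posrE// prodr_gt0.
rewrite -mulrBr.
under eq_bigr do rewrite (ln_wallis_factor K _ x04).
rewrite big_split /= exchange_big /=.
rewrite [X in X + _ - _](_ : _ = \sum_(1 <= n < K.+1)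
    series (alt_power_seq R n) N * (x ^+ n / n%:R)); last first.
  by apply: eq_bigr => n _; rewrite seriesEord /= mulr_suml.
rewrite addrAC subrr add0r normrM ger0_norm//.
apply: (@le_trans _ _ (2 * \sum_(i < N) (2 * x ^+ K.+1 * oddr R i ^- 2))).
  rewrite ler_wpM2l// (le_trans (ler_norm_sum _ _ _))//; apply: ler_sum => i _.
  have o1 := oddr_ge1 R i; rewrite oddr_even.
  have xo y : 1 <= y -> 0 <= x / y <= 1 / 2.
    by move=> y1; rewrite divr_ge0/= ?ler_pdivrMr; lra.
  have /andP[a0 a1] := ln_rest_bounds K (xo _ o1).
  have o2 : 1 <= oddr R i + 1 by lra.
  have /andP[b0 b1] := ln_rest_bounds K (xo _ o2).
  have powle : (x / oddr R i) ^+ K.+1 <= x ^+ K.+1 * oddr R i ^- 2.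
    rewrite expr_div_n ler_wpM2l ?exprn_ge0//.
    rewrite lef_pV2 ?posrE ?exprn_gt0//; [|lra..].
    by rewrite ler_weXn2l// ltnS.
  have powle' : (x / (oddr R i + 1)) ^+ K.+1 <= (x / oddr R i) ^+ K.+1.
    rewrite lerXn2r// ?nnegrE ?divr_ge0//; [lra..|].
    by rewrite ler_wpM2l// lef_pV2 ?posrE; lra.
  rewrite -mulrA ler_norml.
  move: (x ^+ K.+1 * _) ((x / oddr R i) ^+ _) ((x / (oddr R i + 1)) ^+ _)
    (ln_rest _ _) (ln_rest _ _) powle powle' a0 a1 b0 b1 => v1 v2 v3 v4 v5.
  by move=> *; apply/andP; split; lra.
rewrite -mulr_sumr.
have := series_oddr_sqr_le R N; have : 0 <= x ^+ K.+1 by rewrite exprn_ge0.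
move: (\sum_(i < N) _) (x ^+ K.+1) => s y y0 s3.
have : 0 <= y * (3 - s) by apply: mulr_ge0; lra.
lra.
Qed.

(** * Values of the alternating power sums *)

(** Catalan's identity. Its right-hand side, unlike the alternating sum, can be squeezed between
    differences of logarithms. *)
Lemma alt_harmonicE (R : realType) (N : nat) :
  series (@alt_power_seq R 1) N = \sum_(N.+1 <= m < N.*2.+1) m%:R^-1.
Proof.
rewrite seriesEord /=; elim: N => [|N IH]; first by rewrite big_ord0 big_geq.
have lt1 : (N.+1 < N.*2.+3)%N by lia.
rewrite big_ord_recr /= IH doubleS.
apply: (@addrI _ (N.+1%:R^-1)).
rewrite -[in RHS](@big_ltn _ _ _ N.+1 N.*2.+3)//.
rewrite [in RHS]big_nat_recr /=; last by lia.
rewrite [in X in _ = X + _]big_nat_recr /=; last by lia.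
rewrite addrCA -!addrA; congr (_ + _).
rewrite /alt_power_seq !oddr_even !expr1 -/(oddr R N) oddrE -[N.+1%:R]natr1.
have N0 := ler0n R N; move: (N%:R) N0 => y y0; field.
by do ?[apply/andP; split]; apply: lt0r_neq0; lra.
Qed.

Lemma alt_power_sum1 (R : realType) : alt_power_sum R 1 = ln 2.
Proof.
(* Starting at N + 1 keeps ln (m - 1) away from m = 1 in the upper estimate. *)
apply/cvg_lim => //; rewrite -(cvg_shiftS (series _)) /=.
have lnB (m : nat) : ln (m.+2%:R : R) - ln (m.+1%:R : R) <= m.+1%:R^-1 /\
    m.+2%:R^-1 <= ln (m.+2%:R : R) - ln (m.+1%:R : R).
  have m0 := ler0n R m; rewrite -[m.+2%:R]natr1 -[m.+1%:R]natr1.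
  move: (m%:R) m0 => y y0; rewrite -ln_div ?posrE; [|lra..]; split.
    rewrite (_ : _ / _ = 1 + (y + 1)^-1); last by field; apply: lt0r_neq0; lra.
    by apply: le_ln1Dx; rewrite (@lt_le_trans _ _ 0)// ?invr_ge0; lra.
  rewrite -[leLHS]opprK lerNl -lnV ?posrE; last by apply: divr_gt0; lra.
  rewrite (_ : _^-1 = 1 + (- (y + 1 + 1)^-1)); last first.
    by field; apply/andP; split; apply: lt0r_neq0; lra.
  by apply: le_ln1Dx; rewrite ltrN2 invf_lt1; lra.
have upper : (fun N => series (@alt_power_seq R 1) N.+1) =
  fun N => \sum_(N.+2 <= m < N.+1.*2.+1) m%:R^-1.
  by apply/funext => N; exact: alt_harmonicE.
rewrite upper.
apply: (@squeeze_cvgr _ _ _ _ (fun N => ln 2 - harmonic N) (fun=> ln 2)).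
- apply: nearW => N; apply/andP; split.
    (* With n = N + 1, this telescoped lower bound misses ln 2 by ln ((2 n + 2) / (2 n + 1)) <= 1 /
       (2 n + 1). *)
    apply: (@le_trans _ _ (ln (N.+1.*2.+1)%:R - ln (N.+2)%:R)).
      have -> : (N.+1.*2.+1)%:R =
          N.+2%:R * 2 / ((N.+1.*2.+2)%:R / (N.+1.*2.+1)%:R) :> R.
        rewrite [X in _ = _ * _ / (X / _)](_ : _ = N.+2%:R * 2); last first.
          by rewrite -natrM muln2.
        by rewrite invf_div mulrCA divff ?mulr1// mulf_neq0// pnatr_eq0.
      rewrite ln_div ?posrE ?divr_gt0 ?mulr_gt0 ?ltr0n//.
      rewrite lnM ?posrE ?ltr0n// addrAC [_ + ln 2]addrC addrK lerD2l lerN2.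
      rewrite (le_trans (y := (N.+1.*2.+1)%:R^-1))//.
        by rewrite ln_div ?posrE ?ltr0n//; have [] := lnB N.+1.*2.
      by rewrite /harmonic /= lef_pV2 ?posrE ?ltr0n// ler_nat; lia.
    rewrite -(@telescope_sumr _ _ _ (fun m => ln m%:R)); last by lia.
    apply: ler_sum_nat => -[|m] /andP[m1 _] //.
    by have [] := lnB m.
  have -> : ln 2 = ln (N.+1.*2.+1.-1)%:R - ln (N.+2.-1)%:R :> R.
    by rewrite /= -muln2 natrM lnM ?posrE ?ltr0n// addrAC subrr add0r.
  rewrite -(@telescope_sumr _ _ _ (fun k => ln (k.-1)%:R)); last by lia.
  apply: ler_sum_nat => -[|[|m]] /andP[m1 _] //.
  by have [] := lnB m.
- rewrite -[X in _ --> X](subr0 (ln 2)); apply: cvgB; first exact: cvg_cst.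
  exact: cvg_harmonic.
- exact: cvg_cst.
Qed.

Definition odd_zeta (R : realType) (n : nat) : R :=
  limn (series (fun i => oddr R i ^- n)).

Lemma odd_power_bounds (R : realType) (n i : nat) : (2 <= n)%N ->
  0 <= oddr R i ^- n <= oddr R i ^- 2.
Proof.
move=> n2; have o1 := oddr_ge1 R i; have o0 : 0 < oddr R i by lra.
apply/andP; split; first by rewrite invr_ge0 exprn_ge0// ltW.
by rewrite lef_pV2 ?posrE ?exprn_gt0// ler_weXn2l.
Qed.

Lemma cvg_odd_zeta (R : realType) (n : nat) : (2 <= n)%N ->
  cvgn (series (fun i => oddr R i ^- n)).
Proof.
move=> n2; apply: nondecreasing_is_cvgn.
  apply: nondecreasing_series => i _ _.
  by have /andP[] := odd_power_bounds R i n2.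
exists 3 => _ [N _ <-]; rewrite seriesEord /=.
apply: le_trans (series_oddr_sqr_le R N); apply: ler_sum => i _.
by have /andP[] := odd_power_bounds R i n2.
Qed.

Lemma odd_sum0 (R : realType) : odd_sum (0 : R) = odd_zeta R 2.
Proof.
by congr (limn (series _)); apply/funext => i; exact: odd_term0.
Qed.

(** Splitting by parity: the eta value is the odd part minus 2^-n zeta(n), while zeta(n) itself is
    the odd part plus 2^-n zeta(n). *)
Lemma alt_power_sumE (R : realType) (n : nat) : (2 <= n)%N ->
  alt_power_sum R n * (2 ^+ n - 1) = (2 ^+ n - 2) * odd_zeta R n.
Proof.
move=> n2.
pose O := series (fun i => oddr R i ^- n).
pose Z := series (fun i => i.+1%:R ^- n : R).
have cO : O @ \oo --> odd_zeta R n by exact: cvg_odd_zeta.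
have alt N : series (@alt_power_seq R n) N = O N - 2 ^- n * Z N.
  rewrite /O /Z !seriesEord /= mulr_sumr -sumrB; apply: eq_bigr => i _.
  by rewrite /alt_power_seq -doubleS -mul2n natrM exprMn invfM.
have ZD N : Z N.*2 = O N + 2 ^- n * Z N.
  rewrite /O /Z !seriesEord /= mulr_sumr; elim: N => [|N IH].
    by rewrite !big_ord0 addr0.
  rewrite doubleS !big_ord_recr /= {}IH /oddr.
  have -> : N.*2.+2%:R = 2 * N.+1%:R :> R by rewrite -doubleS -mul2n natrM.
  rewrite exprMn invfM; ring.
have Z0 : nondecreasing_seq Z.
  by apply: nondecreasing_series => i _ _; rewrite invr_ge0 exprn_ge0.
have c2 : 0 < 2 ^+ n :> R by rewrite exprn_gt0.
(* Boundedness comes from nonnegativity of the alternating partial sums: Z N <= 2^n O N. *)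
have cvZ : cvgn Z.
  apply: nondecreasing_is_cvgn => //; exists (2 ^+ n * 3) => _ [N _ <-].
  have : 0 <= series (@alt_power_seq R n) N.
    rewrite seriesEord /=; apply: sumr_ge0 => i _.
    by have /andP[] := alt_power_seq_bounds R i (ltnW n2).
  rewrite alt subr_ge0 mulrC ler_pdivrMr// mulrC => /le_trans; apply.
  rewrite ler_pM2l// (le_trans _ (series_oddr_sqr_le R N))// /O seriesEord /=.
  by apply: ler_sum => i _; have /andP[] := odd_power_bounds R i n2.
have cvZ2 : (fun N => Z N.*2) @ \oo --> limn Z.
  apply: (@squeeze_cvgr _ _ _ _ Z (fun=> limn Z)).
  - apply: nearW => N; rewrite Z0 ?nondecreasing_cvgn_le//.
    by rewrite -addnn leq_addr.
  - exact: cvZ.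
  - exact: cvg_cst.
have E1 : limn Z = odd_zeta R n + 2 ^- n * limn Z.
  rewrite -[LHS](cvg_lim _ cvZ2)//; apply/cvg_lim => //.
  under eq_fun do rewrite ZD.
  by apply: cvgD => //; apply: cvgMr.
have E2 : alt_power_sum R n = odd_zeta R n - 2 ^- n * limn Z.
  apply/cvg_lim => //; rewrite (_ : series _ = fun N => O N - 2 ^- n * Z N).
    by apply: cvgB => //; apply: cvgMr.
  by apply/funext => N.
rewrite E2; move: (limn Z) E1 => z E1.
have -> : odd_zeta R n = z - 2 ^- n * z by rewrite {1}E1; ring.
by field; rewrite gt_eqF.
Qed.

(** * Expansion of the odd sum *)

Lemma dist_expR_le (R : realType) (u v : R) :
  `|expR u - expR v| <= `|u - v| * (expR u + expR v).
Proof.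
have main (a b : R) : expR a - expR b <= `|a - b| * (expR a + expR b).
  have := expR_ge1Dx (b - a); rewrite expRB ler_pdivlMr ?expR_gt0// => h.
  have := ler_norm (a - b); have := normr_ge0 (a - b).
  have := expR_gt0 a; have := expR_gt0 b.
  move: (expR a) (expR b) `|a - b| h => x y z h y0 x0 z0 az.
  have : 0 <= z * y by rewrite mulr_ge0// ltW.
  have : 0 <= (z - (a - b)) * x by rewrite mulr_ge0 ?subr_ge0// ltW.
  lra.
rewrite ler_norml main andbT lerNl opprB distrC [expR u + _]addrC.
exact: main.
Qed.

Definition log_coef (R : realType) (i : nat) : R :=
  2 * alt_power_sum R i / i%:R.

Lemma log_coef_ge0 (R : realType) (i : nat) : 0 <= log_coef R i.
Proof.
case: i => [|i]; first by rewrite /log_coef invr0 mulr0.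
by rewrite /log_coef divr_ge0// mulr_ge0// alt_power_sum_ge0.
Qed.

(** The linear term is left out: its coefficient 2 ln 2 produces the powers of log 2 in the theorem,
    the others the factors t(n_i) with n_i >= 2. *)
Definition log_tail (R : realType) (K : nat) (x : R) : R :=
  \sum_(i < K.+1 | (2 <= i)%N) log_coef R i * x ^+ i.

Lemma ln_odd_sum_tail (R : realType) (K : nat) (x : R) : 0 <= x <= 1 / 4 ->
  `|ln (odd_sum x / odd_sum 0) - (2 * ln 2 * x + log_tail K x)|
  <= 12 * x ^+ K.+1.
Proof.
move=> x04; have /andP[x0 x4] := x04.
have tailE L : (0 < L)%N -> 2 * \sum_(1 <= n < L.+1)
    alt_power_sum R n * (x ^+ n / n%:R) = 2 * ln 2 * x + log_tail L x.
  move=> L0; rewrite big_ltn// mulrDr alt_power_sum1 expr1 divr1 mulrA.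
  congr (_ + _); rewrite big_nat_cond mulr_sumr /log_tail.
  rewrite (big_nat_widenl 2 0)// big_mkord; apply: eq_big => i.
    by rewrite ltn_ord; case: ltnP.
  by move=> _; rewrite /log_coef; ring.
(* For K = 0 the estimate of order 1 is used: both tails are empty and 12 x^2 <= 12 x. *)
case: K => [|K]; last by rewrite -tailE//; exact: ln_odd_sum.
have := @ln_odd_sum R 1 x isT x04; rewrite tailE//.
have -> : log_tail 1 x = 0.
  by rewrite /log_tail big_mkcond /= !big_ord_recl big_ord0 /= !addr0.
have -> : log_tail 0 x = 0.
  by rewrite /log_tail big_mkcond /= big_ord_recl big_ord0 /= addr0.
move=> /le_trans; apply.
by rewrite ler_wpM2l// expr2 expr1 ler_piMl//; lra.
Qed.

(** The linear and the higher part of the logarithm are exponentiated separately, so that the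
    product of the truncated series already has the shape of the double sum over n and m. *)
Lemma odd_sum_expand (R : realType) (K : nat) : exists C : R,
  forall x, 0 <= x <= 1 / 4 ->
  `|odd_sum x - odd_sum 0 *
     ((\sum_(n < K.+1) (2 * ln 2 * x) ^+ n / n`!%:R) *
      (\sum_(m < K.+1) log_tail K x ^+ m / m`!%:R))| <= C * x ^+ K.+1.
Proof.
have z04 : 0 <= (0 : R) <= 1 / 4 by apply/andP; split; lra.
have F0 := odd_sum_gt0 z04.
pose a : R := 2 * ln 2.
pose b : R := \sum_(i < K.+1 | (2 <= i)%N) log_coef R i.
have a0 : 0 <= a by rewrite mulr_ge0// ln_ge0// ler1n.
have b0 : 0 <= b by apply: sumr_ge0 => i _; exact: log_coef_ge0.
pose M := expR a * expR b.
have Ma : 1 <= expR a by rewrite -expR0 ler_expR.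
have Mb : 1 <= expR b by rewrite -expR0 ler_expR.
(* The summand with 12 pays for truncating the logarithm, with 3 / [odd_sum 0] bounding the
   exponential of the exact one; the other two pay for truncating the two exponential series. *)
exists (odd_sum 0 *
  (12 * (3 / odd_sum 0 + M) + (a ^+ K.+1 * M + b ^+ K.+1 * M))).
move=> x x04; have /andP[x0 x4] := x04.
have ax0 : 0 <= a * x by rewrite mulr_ge0.
have Bx0 : 0 <= log_tail K x.
  by apply: sumr_ge0 => i _; rewrite mulr_ge0 ?log_coef_ge0// exprn_ge0.
have Bxb : log_tail K x <= b * x.
  rewrite /log_tail /b mulr_suml; apply: ler_sum => i i2.
  rewrite ler_wpM2l ?log_coef_ge0//; case: (nat_of_ord i) i2 => // j _.
  by rewrite exprS ler_piMr// exprn_ile1//; lra.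
have axa : a * x <= a by rewrite ler_piMr//; lra.
have Bb : log_tail K x <= b by apply: (le_trans Bxb); rewrite ler_piMr//; lra.
have /andP[p0 p1] := expR_taylor K ax0.
have /andP[q0 q1] := expR_taylor K Bx0.
have Ea : expR (a * x) <= expR a by rewrite ler_expR.
have Eb : expR (log_tail K x) <= expR b by rewrite ler_expR.
have pw1 : (a * x) ^+ K.+1 <= a ^+ K.+1 * x ^+ K.+1 by rewrite exprMn.
have pw2 : log_tail K x ^+ K.+1 <= b ^+ K.+1 * x ^+ K.+1.
  by rewrite -exprMn lerXn2r// nnegrE mulr_ge0.
have P0 : 0 <= \sum_(n < K.+1) (a * x) ^+ n / n`!%:R.
  by apply: sumr_ge0 => i _; rewrite divr_ge0// exprn_ge0.
have Q0 : 0 <= \sum_(n < K.+1) log_tail K x ^+ n / n`!%:R.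
  by apply: sumr_ge0 => i _; rewrite divr_ge0// exprn_ge0.
have FF0 : 0 < odd_sum x / odd_sum 0 by rewrite divr_gt0// odd_sum_gt0.
have FE : odd_sum x = odd_sum 0 * expR (ln (odd_sum x / odd_sum 0)).
  by rewrite lnK ?posrE// mulrC divfK// gt_eqF.
have F3 : expR (ln (odd_sum x / odd_sum 0)) <= 3 / odd_sum 0.
  rewrite lnK ?posrE// ler_pM2r ?invr_gt0//.
  apply: limr_le; first exact: cvgn_odd_term.
  by apply: nearW => n; exact: series_odd_term_le.
have D1 := dist_expR_le (ln (odd_sum x / odd_sum 0)) (a * x + log_tail K x).
have D2 := @ln_odd_sum_tail R K x x04.
rewrite {1}FE -mulrBr normrM gtr0_norm// -/a -mulrA ler_pM2l//.
have xK : 0 <= x ^+ K.+1 by rewrite exprn_ge0.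
have aK : 0 <= a ^+ K.+1 by rewrite exprn_ge0.
have bK : 0 <= b ^+ K.+1 by rewrite exprn_ge0.
rewrite -/a in D2; move: D1; rewrite expRD.
move: (expR_ge0 (a * x)) (expR_ge0 (log_tail K x)).
set eA := expR (a * x) in p0 p1 Ea *.
set eB := expR (log_tail K x) in q0 q1 Eb *.
move: p0 p1 q0 q1 P0 Q0; set P := \sum_(n < _) _; set Q := \sum_(n < _) _.
move=> p0 p1 q0 q1 P0 Q0 eA0 eB0 D1.
set eL := expR (ln _) in F3 D1 *.
have eL0 : 0 <= eL by exact: expR_ge0.
have eAB : eA * eB <= M by rewrite /M ler_pM.
apply: (le_trans (ler_distD (eA * eB) _ _)).
rewrite mulrDl; apply: lerD.
  apply: (le_trans D1); rewrite [leRHS]mulrAC; apply: ler_pM => //.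
    by rewrite addr_ge0// mulr_ge0.
  by apply: lerD.
have -> : eA * eB - P * Q = (eA - P) * eB + P * (eB - Q) by ring.
rewrite ger0_norm; last by rewrite addr_ge0// mulr_ge0.
rewrite [leRHS]mulrDl; apply: lerD.
  rewrite [leRHS]mulrAC [leRHS]mulrA; apply: ler_pM => //.
  apply: (le_trans p1); apply: ler_pM => //; exact: exprn_ge0.
rewrite [leRHS](_ : _ = expR a * (b ^+ K.+1 * x ^+ K.+1 * expR b));
  last by rewrite /M; ring.
apply: ler_pM => //.
  by apply: le_trans Ea; rewrite -subr_ge0.
by apply: (le_trans q1); apply: ler_pM => //; exact: exprn_ge0.
Qed.

(** Stands in for uniqueness of power series: the constant coefficient vanishes by letting x tend to
    0, then p is divided by X and K decreases. *)
Lemma poly_coef_small (R : realType) (p : {poly R}) (C : R) (K : nat) :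
  (forall x, 0 < x <= 1 / 4 -> `|p.[x]| <= C * x ^+ K.+1) ->
  forall i, (i <= K)%N -> p`_i = 0.
Proof.
have const (q : {poly R}) (D : R) :
    (forall x, 0 < x <= 1 / 4 -> `|q.[x]| <= D * x) -> q`_0 = 0.
  move=> qD; pose M := \sum_(i < size (drop_poly 1 q)) `|(drop_poly 1 q)`_i|.
  have M0 : 0 <= M by apply: sumr_ge0.
  have D0 : 0 <= D.
    have := qD (1 / 4) ltac:(apply/andP; split; lra).
    by move=> /(le_trans (normr_ge0 _)); rewrite pmulr_lge0//; lra.
  have key x : 0 < x <= 1 / 4 -> `|q`_0| <= (D + M) * x.
    move=> x04; have /andP[x0 x4] := x04.
    have qE : q.[x] = q`_0 + (drop_poly 1 q).[x] * x.
      rewrite -[in LHS](poly_take_drop 1 q) hornerD hornerM hornerXn expr1.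
      congr (_ + _).
      by rewrite /take_poly poly_def big_ord1 expr0 hornerZ hornerC mulr1.
    have -> : q`_0 = q.[x] - (drop_poly 1 q).[x] * x by rewrite qE addrK.
    rewrite (le_trans (ler_normB _ _))// mulrDl lerD ?qD//.
    rewrite normrM (gtr0_norm x0) ler_wpM2r ?(ltW x0)// horner_coef.
    rewrite (le_trans (ler_norm_sum _ _ _))//; apply: ler_sum => i _.
    rewrite normrM ler_piMr// normrX exprn_ile1 ?normr_ge0// gtr0_norm//; lra.
  apply/eqP; rewrite -normr_eq0 eq_le normr_ge0 andbT.
  apply/ler_addgt0Pr => e e0; rewrite add0r.
  pose x := Num.min (1 / 4) (e / (D + M + 1)).
  have x0 : 0 < x.
    by rewrite /x lt_min; apply/andP; split; [lra|apply: divr_gt0; lra].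
  have x4 : x <= 1 / 4 by rewrite /x ge_min lexx.
  have xe : x <= e / (D + M + 1) by rewrite /x ge_min lexx orbT.
  rewrite (le_trans (key x _)) ?x0//.
  move: xe; rewrite ler_pdivlMr; last lra.
  lra.
elim: K p => [|K IH] p pC.
  by case=> // _; apply: (const p C) => x /pC.
have p0 : p`_0 = 0.
  (* No sign is assumed on C, while weakening x^(K+2) to x needs a nonnegative constant. *)
  apply: (const p (Num.max C 0)) => x x04; have /andP[x0 x4] := x04.
  apply: (le_trans (pC x x04)).
  have [C1 C0] : C <= Num.max C 0 /\ 0 <= Num.max C 0.
    by rewrite !le_max !lexx orbT.
  apply: (@le_trans _ _ (Num.max C 0 * x ^+ K.+2)).
    by rewrite ler_wpM2r// exprn_ge0// ltW.
  rewrite ler_wpM2l// exprS ler_piMr// ?(ltW x0)// exprn_ile1 ?(ltW x0)//.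
  lra.
have pE : p = drop_poly 1 p * 'X.
  rewrite -[LHS](poly_take_drop 1 p) expr1 [take_poly _ _](_ : _ = 0) ?add0r//.
  by rewrite /take_poly poly_def big_ord1 p0 scale0r.
case=> [|i] iK //; rewrite pE coefMX /=.
apply: IH => // x x04; have /andP[x0 x4] := x04.
have := pC x x04; rewrite {1}pE hornerMX normrM (gtr0_norm x0) exprSr mulrA.
by rewrite ler_pM2r.
Qed.

Lemma big_tuple_cons (R : Type) (idx : R) (op : Monoid.com_law idx)
    (T : finType) (m : nat) (P : pred (m.+1.-tuple T))
    (F : m.+1.-tuple T -> R) :
  \big[op/idx]_(s : m.+1.-tuple T | P s) F s =
  \big[op/idx]_(x : T) \big[op/idx]_(s : m.-tuple T | P [tuple of x :: s])
     F [tuple of x :: s].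
Proof.
rewrite pair_big_dep /=.
rewrite (reindex (fun p : T * m.-tuple T => [tuple of p.1 :: p.2])) //=.
exists (fun s => (thead s, [tuple of behead s])) => [[x s] _|s _] /=.
  by rewrite theadE; congr (_, _); apply: val_inj.
by apply: val_inj; rewrite /= [in RHS](tuple_eta s).
Qed.

Lemma poly_sum_exp (R : comNzRingType) (N m : nat) (P : pred 'I_N)
    (c : 'I_N -> R) :
  (\sum_(i < N | P i) c i *: 'X^i) ^+ m =
  \sum_(s : m.-tuple 'I_N | all P s)
    (\prod_(x <- s) c x) *: 'X^(\sum_(x <- s) (x : nat)) :> {poly R}.
Proof.
elim: m => [|m IH].
  rewrite expr0 (big_pred1 [tuple]); first by rewrite !big_nil expr0 scale1r.
  by move=> s; rewrite tuple0 /= eqxx.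
rewrite big_tuple_cons exprS IH big_mkcond mulr_suml; apply: eq_bigr => x _ /=.
case: (P x) => /=; last by rewrite mul0r big_pred0.
rewrite mulr_sumr; apply: eq_bigr => s _.
by rewrite !big_cons -scalerAl -scalerAr scalerA exprD.
Qed.

(** With K = k - 2 this is a^k times the right-hand side of the theorem; the ranges agree with those
    of [rhs_sum], so the two match term by term. *)
Definition expand_coef (R : realType) (K : nat) : R :=
  odd_sum 0 * \sum_(n < K.+1) \sum_(m < K.+1)
     \sum_(s : m.-tuple 'I_K.+1 |
            all (fun x : 'I_K.+1 => (2 <= x)%N) s
            && (n + \sum_(x <- s) (x : nat) == K)%N)
       (2 * ln 2) ^+ n / n`!%:R * (m`!%:R^-1 * \prod_(x <- s) log_coef R x).

(** The approximants c are arbitrary, so the expansion through chains can be confronted with the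
    exponential one without knowing that either power series converges. *)
Lemma odd_sum_coef (R : realType) (K : nat) (c : nat -> R) (C : R) :
  (forall x, 0 < x <= 1 / 4 ->
    `|odd_sum x - \sum_(k < K.+1) c k * x ^+ k| <= C * x ^+ K.+1) ->
  c K = expand_coef R K.
Proof.
move=> cC; have [D hD] := odd_sum_expand R K.
pose A : {poly R} := \sum_(n < K.+1) ((2 * ln 2) ^+ n / n`!%:R) *: 'X^n.
pose B : {poly R} := \sum_(i < K.+1 | (2 <= i)%N) log_coef R i *: 'X^i.
pose E : {poly R} := \sum_(m < K.+1) m`!%:R^-1 *: B ^+ m.
pose q : {poly R} := (odd_sum 0) *: (A * E).
pose p : {poly R} := \poly_(k < K.+1) c k.
have small x : 0 < x <= 1 / 4 -> `|(p - q).[x]| <= (C + D) * x ^+ K.+1.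
  move=> x04; have /andP[x0 x4] := x04.
  have x04' : 0 <= x <= 1 / 4 by rewrite ltW.
  have -> : (p - q).[x] = - (odd_sum x - \sum_(k < K.+1) c k * x ^+ k) +
      (odd_sum x - odd_sum 0 *
     ((\sum_(n < K.+1) (2 * ln 2 * x) ^+ n / n`!%:R) *
      (\sum_(m < K.+1) log_tail K x ^+ m / m`!%:R))).
    rewrite hornerD hornerN [p.[x]]horner_poly.
    rewrite [X in _ - X](_ : _ = odd_sum 0 *
      ((\sum_(n < K.+1) (2 * ln 2 * x) ^+ n / n`!%:R) *
       (\sum_(m < K.+1) log_tail K x ^+ m / m`!%:R))); first by ring.
    rewrite hornerZ hornerM; congr (_ * (_ * _)); rewrite horner_sum.
      by apply: eq_bigr => i _; rewrite hornerZ hornerXn [in RHS]exprMn mulrAC.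
    apply: eq_bigr => i _; rewrite hornerZ horner_exp mulrC; congr (_ ^+ _ * _).
    by rewrite horner_sum; apply: eq_bigr => j _; rewrite hornerZ hornerXn.
  rewrite (le_trans (ler_normD _ _))// normrN [leRHS]mulrDl lerD ?cC ?hD//.
have := @poly_coef_small R (p - q) (C + D) K small K (leqnn _).
rewrite coefB coef_poly ltnSn => /eqP; rewrite subr_eq0 => /eqP ->.
rewrite coefZ /expand_coef; congr (_ * _).
rewrite mulr_suml coef_sum; apply: eq_bigr => n _.
rewrite mulr_sumr coef_sum; apply: eq_bigr => m _.
rewrite /B poly_sum_exp scaler_sumr mulr_sumr coef_sum [RHS]big_mkcondr.
apply: eq_bigr => s _.
rewrite scalerA -scalerAl -scalerAr scalerA -exprD coefZ coefXn eq_sym.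
by case: eqP => _; rewrite ?mulr1 ?mulr0.
Qed.

(** * Generating functions of chains *)

(* Sum over compositions of [w] into [n] parts and over chains of odd numbers
   below the [J]-th one; [b = 0] gives strict chains, [b = 1] weak ones. *)
Fixpoint chain_sum (R : realType) (b n J w : nat) : R :=
  if n is n'.+1 then
    \sum_(j < J) \sum_(1 <= i < w.+1)
      oddr R j ^- i * chain_sum R b n' (j + b) (w - i)
  else (w == 0)%:R.

(** Coefficient of x^w in the product of the (o_i + x) / (o_i - x), i < J. With y = x / o, a strict
    chain meets o at most once and gives 1 + 2 y / (1 - y); a weak chain repeats it freely and, with
    x and 2 replaced by -x and -2, gives the geometric series 1 / (1 - 2 y / (1 + y)). Both equal (1
    + y) / (1 - y). *)
Definition chain_gen (R : realType) (b J w : nat) : R :=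
  \sum_(n < w.+1) ((-1) ^+ b) ^+ (w + n) * 2 ^+ n * chain_sum R b n J w.

(** Coefficient of x^w in [odd_term x J]; the exponent i + 2 encodes k_1 > 1. For b = 1 the top
    entry contributes 1 / (o (o + x)), but the chain may reuse o, which restores the factor (o + x)
    / (o - x). *)
Definition top_gen (R : realType) (b J w : nat) : R :=
  \sum_(i < w.+1) ((-1) ^+ b) ^+ i * oddr R J ^- i.+2 *
    chain_gen R b (J + b) (w - i).

Lemma chain_sum_eq0 (R : realType) (b n J w : nat) :
  (w < n)%N -> chain_sum R b n J w = 0.
Proof.
elim: n J w => [|n IH] J w // wn /=; rewrite big1// => j _.
rewrite big_nat big1// => i /andP[i0 iw]; rewrite IH ?mulr0//; lia.
Qed.

Lemma chain_genE (R : realType) (b J w N : nat) : (w < N)%N ->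
  chain_gen R b J w =
  \sum_(n < N) ((-1) ^+ b) ^+ (w + n) * 2 ^+ n * chain_sum R b n J w.
Proof.
move=> wN; rewrite /chain_gen (big_ord_widen N
  (fun n => ((-1) ^+ b) ^+ (w + n) * 2 ^+ n * chain_sum R b n J w) wN).
rewrite big_mkcond; apply: eq_bigr => n _; case: ltnP => // wn.
by rewrite chain_sum_eq0 ?mulr0.
Qed.

Lemma chain_gen_ord0 (R : realType) (b w : nat) :
  chain_gen R b 0 w = (w == 0)%:R.
Proof.
rewrite /chain_gen big_ord_recl big1 => [|i _];
  last by rewrite /= big_ord0 mulr0.
rewrite addr0 addn0 expr0 mulr1 /=; case: eqP => [->|]; rewrite ?mulr0//.
by rewrite expr0 mul1r.
Qed.

Lemma chain_gen_w0 (R : realType) (b J : nat) : chain_gen R b J 0 = 1.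
Proof. by rewrite /chain_gen big_ord1 /= !mulr1. Qed.

(** Only chains with largest entry o_J survive in the difference; removing that entry lowers n by
    one, whence the factor 2 and the sign exponent i + 1. *)
Lemma chain_gen_diff (R : realType) (b J w : nat) :
  chain_gen R b J.+1 w - chain_gen R b J w =
  2 * \sum_(1 <= i < w.+1) ((-1) ^+ b) ^+ i.+1 * oddr R J ^- i *
        chain_gen R b (J + b) (w - i).
Proof.
have wN : (w < w.+2)%N by [].
rewrite !(chain_genE R b _ wN) -sumrB big_ord_recl /= subrr add0r.
under eq_bigr => n _ do
  rewrite big_ord_recr /= mulrDr addrAC subrr add0r mulr_sumr.
rewrite exchange_big mulr_sumr /= !big_nat.
apply: eq_bigr => i /andP[i0 iw].
have wiN : (w - i < w.+1)%N by lia.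
rewrite (chain_genE R b _ wiN) mulr_sumr mulr_sumr; apply: eq_bigr => n _.
rewrite (_ : w + bump 0 n = i.+1 + (w - i + n))%N;
  last by rewrite /bump /=; lia.
rewrite [in LHS]exprD [2 ^+ _]exprS; ring.
Qed.

(** Coefficient form of (o_J - x) P_(J+1) = (o_J + x) P_J, the same for both b. Multiplying the
    difference by o_J shifts the sum over i by one step, so that all but its first term reproduce
    the difference at w, up to the sign (-1)^b. *)
Lemma chain_gen_rec (R : realType) (b J w : nat) : (b < 2)%N ->
  oddr R J * chain_gen R b J.+1 w.+1 =
  chain_gen R b J.+1 w + oddr R J * chain_gen R b J w.+1 + chain_gen R b J w.
Proof.
move=> b2; have o1 := oddr_ge1 R J.
have o0 : oddr R J != 0 by apply: lt0r_neq0; lra.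
have E : oddr R J * (chain_gen R b J.+1 w.+1 - chain_gen R b J w.+1) =
    2 * chain_gen R b (J + b) w +
    (-1) ^+ b * (chain_gen R b J.+1 w - chain_gen R b J w).
  rewrite !chain_gen_diff big_ltn// big_add1 /= subSS subn0 mulrDr mulrDr.
  congr (_ + _).
    case: b b2 => [|[|//]] _; rewrite ?expr0 ?expr1 ?expr1n; field => //.
  rewrite !mulr_sumr; apply: eq_bigr => i _.
  rewrite subSS [in LHS]exprS [oddr R J ^+ i.+1]exprS invfM.
  by move: (oddr R J) o0 => o o0; field; rewrite o0 expf_neq0.
move: E; rewrite mulrBr => /eqP; rewrite subr_eq => /eqP ->.
case: b b2 => [|[|//]] _; rewrite ?addn0 ?addn1 ?expr0 ?expr1; ring.
Qed.

Lemma chain_gen_weak_strict (R : realType) (J w : nat) :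
  chain_gen R 1 J w = chain_gen R 0 J w.
Proof.
elim: J w => [|J IHJ] w; first by rewrite !chain_gen_ord0.
have o0 : oddr R J != 0 by have := oddr_ge1 R J => o1; apply: lt0r_neq0; lra.
elim: w => [|w IHw]; first by rewrite !chain_gen_w0.
by apply: (mulfI o0); rewrite !chain_gen_rec// IHw !IHJ.
Qed.

Lemma top_gen0 (R : realType) (b J : nat) : top_gen R b J 0 = oddr R J ^- 2.
Proof. by rewrite /top_gen big_ord1 subn0 chain_gen_w0 expr0 mul1r mulr1. Qed.

Lemma top_genS (R : realType) (b J w : nat) :
  oddr R J ^+ 2 * top_gen R b J w.+1 =
  chain_gen R b (J + b) w.+1 + (-1) ^+ b * oddr R J * top_gen R b J w.
Proof.
have o0 : oddr R J != 0 by have := oddr_ge1 R J => o1; apply: lt0r_neq0; lra.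
rewrite /top_gen big_ord_recl mulrDr; congr (_ + _).
  by rewrite /= subn0 expr0 mul1r mulrA divff ?mul1r// expf_neq0.
rewrite !mulr_sumr; apply: eq_bigr => i _.
rewrite /= subSS expr2 [((-1) ^+ b) ^+ _.+1]exprS [oddr R J ^+ _.+3]exprS.
by move: (oddr R J) o0 => o o0; field; rewrite o0 expf_neq0.
Qed.

(** For the series P_J and T_J with coefficients [chain_gen] and [top_gen], this is P_(J+1) - P_J =
    2 x P_J / (o_J - x) with P_J = o_J (o_J - x) T_J inserted. *)
Lemma chain_gen_top (R : realType) (J w : nat) :
  chain_gen R 0 J.+1 w.+1 =
  chain_gen R 0 J w.+1 + 2 * oddr R J * top_gen R 0 J w.
Proof.
have o0 : oddr R J != 0 by have := oddr_ge1 R J => o1; apply: lt0r_neq0; lra.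
apply: (mulfI o0); elim: w => [|w IH].
  by rewrite chain_gen_rec// !chain_gen_w0 top_gen0; field.
rewrite chain_gen_rec//.
have := top_genS R 0 J w; rewrite addn0 expr0 mul1r => E.
have -> : oddr R J *
    (chain_gen R 0 J w.+2 + 2 * oddr R J * top_gen R 0 J w.+1) =
  oddr R J * chain_gen R 0 J w.+2 + 2 * (oddr R J ^+ 2 * top_gen R 0 J w.+1).
  by ring.
by rewrite E (mulfI o0 IH); ring.
Qed.

(** The first equality of the theorem already holds for each fixed largest entry. The weak recursion
    subtracts o_J times the previous coefficient, but its chain, which may reuse o_J, brings twice
    that amount by [chain_gen_top]. *)
Lemma top_gen_weak_strict (R : realType) (J w : nat) :
  top_gen R 1 J w = top_gen R 0 J w.
Proof.
have o0 : oddr R J != 0 by have := oddr_ge1 R J => o1; apply: lt0r_neq0; lra.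
elim: w => [|w IH]; first by rewrite !top_gen0.
apply: (mulfI (expf_neq0 2 o0)); rewrite !top_genS IH addn0 addn1.
by rewrite chain_gen_weak_strict chain_gen_top expr0 expr1; ring.
Qed.

Lemma chain_gen_ge0 (R : realType) (J w : nat) : 0 <= chain_gen R 0 J w.
Proof.
elim: J w => [|J IHJ] w; first by rewrite chain_gen_ord0.
have o0 : 0 < oddr R J by have := oddr_ge1 R J => o1; lra.
elim: w => [|w IHw]; first by rewrite chain_gen_w0.
by rewrite -(pmulr_rge0 _ o0) chain_gen_rec// !addr_ge0// mulr_ge0// ltW.
Qed.

Lemma top_gen_ge0 (R : realType) (J w : nat) : 0 <= top_gen R 0 J w.
Proof.
apply: sumr_ge0 => i _; rewrite expr1n mul1r mulr_ge0 ?chain_gen_ge0//.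
by rewrite invr_ge0 exprn_ge0// ler0n.
Qed.

(** For a series with nonnegative coefficients, the Taylor remainder divided by x^(K+1) is
    increasing, so its value at 1/4 controls it; the induction carries just this comparison. *)
Lemma odd_prod_rest (R : realType) (K J : nat) : exists r : R -> R,
  (forall x, 0 <= x <= 1 / 4 -> odd_prod x J =
     \sum_(w < K.+1) chain_gen R 0 J w * x ^+ w + x ^+ K.+1 * r x) /\
  (forall x, 0 <= x <= 1 / 4 -> 0 <= r x <= r (1 / 4)).
Proof.
elim: J => [|J [r [rE rB]]].
  exists (fun=> 0); split=> x _; last by rewrite lexx.
  rewrite /odd_prod big_ord0 mulr0 addr0 big_ord_recl big1.
    by rewrite chain_gen_ord0 expr0 mulr1 addr0.
  by move=> i _; rewrite chain_gen_ord0 mul0r.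
have o1 := oddr_ge1 R J.
(* The two terms of degree K + 1 left over when the recurrence [chain_gen_rec] is cut at degree
   K. *)
pose h := chain_gen R 0 J K + chain_gen R 0 J.+1 K.
have h0 : 0 <= h by rewrite addr_ge0 ?chain_gen_ge0.
exists (fun x => ((oddr R J + x) * r x + h) / (oddr R J - x)); split.
  move=> x x04; have /andP[x0 x4] := x04.
  have key : (oddr R J - x) * \sum_(w < K.+1) chain_gen R 0 J.+1 w * x ^+ w =
      (oddr R J + x) * \sum_(w < K.+1) chain_gen R 0 J w * x ^+ w
      - h * x ^+ K.+1.
    rewrite /h; elim: (K) => [|L IH].
      by rewrite !big_ord1 !chain_gen_w0 expr1; ring.
    rewrite big_ord_recr [in RHS]big_ord_recr /= !mulrDr {}IH.
    have := chain_gen_rec R J L (isT : (0 < 2)%N).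
    set c1 := chain_gen R 0 J.+1 L.+1; set c2 := chain_gen R 0 J.+1 L.
    set c3 := chain_gen R 0 J L.+1; set c4 := chain_gen R 0 J L => E.
    rewrite [x ^+ L.+2]exprS; apply/eqP; rewrite -subr_eq0; apply/eqP.
    transitivity (x ^+ L.+1 * (oddr R J * c1 - (c2 + oddr R J * c3 + c4))).
      ring.
    by rewrite E subrr mulr0.
  have d0 : oddr R J - x != 0 by apply: lt0r_neq0; lra.
  apply: (mulfI d0); rewrite mulrDr key odd_prodS rE//.
  by move: (\sum_(w < K.+1) _) (oddr R J) d0 => s o d0; field.
move=> x x04; have /andP[x0 x4] := x04; have /andP[r0 r1] := rB x x04.
apply/andP; split.
  apply: divr_ge0; last lra.
  by rewrite addr_ge0// mulr_ge0//; lra.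
apply: ler_pM; [|by rewrite invr_ge0; lra| |by rewrite lef_pV2 ?posrE; lra].
  by rewrite addr_ge0// mulr_ge0//; lra.
by apply: lerD => //; apply: ler_pM => //; lra.
Qed.

(** At x = 1/4 the remainder is at most [odd_term (1 / 4) J], and its quotient by x^(K+1) is largest
    there; this explains 4^(K+1) and gives a bound summable over J. *)
Lemma odd_term_taylor (R : realType) (K J : nat) (x : R) : 0 <= x <= 1 / 4 ->
  0 <= odd_term x J - \sum_(w < K.+1) top_gen R 0 J w * x ^+ w
    <= 4 ^+ K.+1 * odd_term (1 / 4) J * x ^+ K.+1.
Proof.
have [r [rE rB]] := odd_prod_rest R K J.
have o1 := oddr_ge1 R J; set e := top_gen R 0 J K.
have e0 : 0 <= e by exact: top_gen_ge0.
pose u (x : R) := (r x + oddr R J * e) / (oddr R J * (oddr R J - x)).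
have key (y : R) : 0 <= y <= 1 / 4 ->
    odd_term y J - \sum_(w < K.+1) top_gen R 0 J w * y ^+ w = y ^+ K.+1 * u y.
  move=> y04; have /andP[y0 y4] := y04.
  have sumE : (oddr R J * (oddr R J - y)) *
      \sum_(w < K.+1) top_gen R 0 J w * y ^+ w =
      \sum_(w < K.+1) chain_gen R 0 J w * y ^+ w - oddr R J * e * y ^+ K.+1.
    rewrite /e; elim: (K) => [|L IH].
      rewrite !big_ord1 chain_gen_w0 top_gen0; field.
      by apply: lt0r_neq0; lra.
    rewrite big_ord_recr [in RHS]big_ord_recr /= mulrDr {}IH.
    have := top_genS R 0 J L; rewrite addn0 expr0 mul1r => E.
    have -> : chain_gen R 0 J L.+1 =
      oddr R J ^+ 2 * top_gen R 0 J L.+1 - oddr R J * top_gen R 0 J L.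
      by rewrite E addrK.
    rewrite [y ^+ L.+2]exprS; ring.
  have d0 : oddr R J * (oddr R J - y) != 0.
    by apply: lt0r_neq0; apply: mulr_gt0; lra.
  apply: (mulfI d0); rewrite mulrBr sumE /odd_term rE// /u.
  move: (\sum_(w < K.+1) _) => s; field.
  by apply/andP; split; apply: lt0r_neq0; lra.
move=> x04; have /andP[x0 x4] := x04; have /andP[r0 r1] := rB x x04.
have u0 : 0 <= u x.
  by rewrite /u divr_ge0//; [rewrite addr_ge0// mulr_ge0|rewrite mulr_ge0]; lra.
have u1 : u x <= u (1 / 4).
  apply: ler_pM; [by rewrite addr_ge0// mulr_ge0//; lra| | |].
  - by rewrite invr_ge0 mulr_ge0; lra.
  - by rewrite lerD2r.
  - rewrite lef_pV2 ?posrE ?mulr_gt0//; [|lra..].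
    by rewrite ler_wpM2l//; lra.
have x04' : 0 <= (1 / 4 : R) <= 1 / 4 by apply/andP; split; lra.
have u2 : u (1 / 4) <= 4 ^+ K.+1 * odd_term (1 / 4) J.
  have := key _ x04'.
  have : 0 <= \sum_(w < K.+1) top_gen R 0 J w * (1 / 4) ^+ w.
    apply: sumr_ge0 => w _; rewrite mulr_ge0 ?top_gen_ge0// exprn_ge0//; lra.
  rewrite div1r exprVn => s0 /(canRL (subrK _)) ->.
  rewrite mulrDr mulrA divff ?expf_neq0 ?pnatr_eq0// mul1r lerDl.
  by rewrite mulr_ge0// exprn_ge0.
rewrite key// mulr_ge0 ?exprn_ge0//= mulrC ler_wpM2r ?exprn_ge0//.
exact: le_trans u2.
Qed.

Lemma cvgn_top_gen (R : realType) (w : nat) :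
  cvgn (series (fun J => top_gen R 0 J w)).
Proof.
have x04 : 0 <= (1 / 4 : R) <= 1 / 4 by apply/andP; split; lra.
have x01 : 0 <= (1 / 4 : R) < 1 by apply/andP; split; lra.
apply: (@series_le_cvg _ _ (fun J => 4 ^+ w * odd_term (1 / 4) J)).
- by move=> J; exact: top_gen_ge0.
- by move=> J; rewrite mulr_ge0 ?exprn_ge0// ltW// odd_term_gt0.
- move=> J; have /andP[+ _] := odd_term_taylor w J x04.
  rewrite subr_ge0 big_ord_recr /= => h.
  have : top_gen R 0 J w * (1 / 4) ^+ w <= odd_term (1 / 4) J.
    apply: le_trans h; rewrite lerDr; apply: sumr_ge0 => i _.
    by rewrite mulr_ge0 ?top_gen_ge0// exprn_ge0//; lra.
  by rewrite div1r exprVn ler_pdivrMr ?exprn_gt0// mulrC.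
by apply: (@is_cvg_seriesZ _ _ (4 ^+ w)); exact: cvgn_odd_term.
Qed.

Lemma top_gen_sum (R : realType) (K : nat) :
  limn (series (fun J => top_gen R 0 J K)) = expand_coef R K.
Proof.
have x04' : 0 <= (1 / 4 : R) <= 1 / 4 by apply/andP; split; lra.
apply: (@odd_sum_coef R K (fun w => limn (series (fun J => top_gen R 0 J w)))
  (4 ^+ K.+1 * odd_sum (1 / 4))) => x /andP[/ltW x0 x4].
have x04 : 0 <= x <= 1 / 4 by rewrite x0.
pose d N := series (odd_term x) N -
  \sum_(k < K.+1) series (fun J => top_gen R 0 J k) N * x ^+ k.
have cd : d @ \oo --> odd_sum x -
    \sum_(k < K.+1) limn (series (fun J => top_gen R 0 J k)) * x ^+ k.
  apply: cvgB; first exact: cvgn_odd_term.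
  by apply: cvg_sumr => k _; apply: cvgMl; exact: cvgn_top_gen.
have cnd : `|d N| @[N --> \oo] --> `|odd_sum x -
    \sum_(k < K.+1) limn (series (fun J => top_gen R 0 J k)) * x ^+ k|.
  exact: cvg_norm.
rewrite -(cvg_lim _ cnd)//; apply: limr_le; first exact: cvgP cnd.
apply: nearW => N; have -> : d N = \sum_(J < N)
    (odd_term x J - \sum_(k < K.+1) top_gen R 0 J k * x ^+ k).
  rewrite /d seriesEord /= sumrB; congr (_ - _).
  rewrite [RHS]exchange_big; apply: eq_bigr => k _.
  by rewrite seriesEord /= mulr_suml.
rewrite ger0_norm; last first.
  by apply: sumr_ge0 => J _; have /andP[] := odd_term_taylor K J x04.
apply: (@le_trans _ _ (4 ^+ K.+1 * series (odd_term (1 / 4)) N * x ^+ K.+1)).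
  rewrite seriesEord /= mulr_sumr mulr_suml; apply: ler_sum => J _.
  by have /andP[] := odd_term_taylor K J x04.
rewrite ler_wpM2r ?exprn_ge0// ler_wpM2l ?exprn_ge0//.
apply: nondecreasing_cvgn_le; last exact: cvgn_odd_term.
apply: nondecreasing_series => j _ _; apply/ltW/odd_term_gt0.
by apply/andP; split; lra.
Qed.

(** * Multiple series as iterated sums *)

Local Open Scope ereal_scope.

Definition chain_from (leT : rel nat) (N a n x : nat) : set (n.-tuple nat) :=
  [set m : n.-tuple nat | path leT x m && mpos_cong N a m].

Definition chain_top (leT : rel nat) (N a n : nat) (D : set nat) :
    set (n.+1.-tuple nat) :=
  [set m : n.+1.-tuple nat | exists2 x, D x &
     exists2 m', chain_from leT N a x m' & m = [tuple of x :: m']].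

Arguments chain_from leT N a n x : clear implicits.
Arguments chain_top leT N a n D : clear implicits.

Lemma esum_chain_top (R : realType) (leT : rel nat) (N a n : nat)
    (D : set nat) (F : n.+1.-tuple nat -> \bar R) : (forall m, 0 <= F m) ->
  \esum_(m in chain_top leT N a n D) F m =
  \esum_(x in D) \esum_(m in chain_from leT N a n x) F [tuple of x :: m].
Proof.
move=> F0; rewrite esum_esum; last by move=> *; exact: F0.
rewrite (@reindex_esum _ _ _ (D `*`` (chain_from leT N a n)) _
  (fun z => [tuple of z.1 :: z.2])) //.
split.
- by move=> [x m] /= [Dx xm]; exists x => //; exists m.
- move=> [x m] [y m'] _ _ /= /(congr1 val) /= [-> mm].
  by congr (_, _); exact: val_inj.
- by move=> _ [x Dx [m xm ->]]; exists (x, m).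
Qed.

Lemma mterm_cons (R : realType) (n x y : nat) (k m : n.-tuple nat) :
  mterm R [tuple of x :: k] [tuple of y :: m] = (y%:R ^- x * mterm R k m)%R.
Proof.
rewrite /mterm big_ord_recl /=; congr (_ * _)%R.
by apply: eq_bigr => i _; rewrite !tnthS.
Qed.

Lemma mterm_ge0 (R : realType) (n : nat) (k m : n.-tuple nat) :
  (0 <= mterm R k m)%R.
Proof. by apply: prodr_ge0 => i _; rewrite invr_ge0 exprn_ge0. Qed.

(** The choice N = 2 a enters here: the summation variables are a times the odd numbers, so a^-k
    factors out of every series. *)
Lemma pos_congP (a x : nat) : (0 < a)%N ->
  ((0 < x)%N && (x == a %[mod 2 * a])%N) <-> exists j, x = (a * j.*2.+1)%N.
Proof.
move=> a0; have aa : (a < 2 * a)%N by rewrite mul2n -addnn -addn1 leq_add2l.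
split=> [/andP[x0 /eqP]|[j ->]].
  rewrite [in RHS]modn_small// => xa; exists (x %/ (2 * a))%N.
  by rewrite {1}(divn_eq x (2 * a)) xa -muln2; ring.
have -> : (a * j.*2.+1 = j * (2 * a) + a)%N by rewrite -muln2; ring.
by rewrite addn_gt0 a0 orbT modnMDl eqxx.
Qed.

Lemma esum_oddr (R : realType) (a : nat) (D : set nat) (F : nat -> \bar R) :
  (0 < a)%N -> (forall x, 0 <= F x) ->
  \esum_(x in [set x | (0 < x)%N && (x == a %[mod 2 * a])%N /\ D x]) F x =
  \esum_(j in [set j | D (a * j.*2.+1)%N]) F (a * j.*2.+1)%N.
Proof.
move=> a0 F0; apply: (@reindex_esum _ _ _ _ _ (fun j => a * j.*2.+1)%N).
split.
- by move=> j Dj /=; split => //; apply/(pos_congP _ a0); exists j.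
- by move=> i j _ _ /eqP; rewrite eqn_pmul2l// eqSS => /eqP /double_inj.
- by move=> x /= [/(pos_congP _ a0)[j ->] Dx]; exists j.
Qed.

Lemma esum_ord (R : realType) (J : nat) (F : nat -> R) :
  (forall j, 0 <= F j)%R ->
  \esum_(j in [set j | (j < J)%N]) (F j)%:E = (\sum_(j < J) F j)%:E.
Proof.
move=> F0; rewrite esum_fset => [||j _]; last by rewrite lee_fin.
- by rewrite -fsbig_ord sumEFin.
- exact: finite_II.
Qed.

Lemma esum_nat_limn (R : realType) (F : nat -> R) :
  (forall j, 0 <= F j)%R -> cvgn (series F) ->
  \esum_(j in [set: nat]) (F j)%:E = (limn (series F))%:E.
Proof.
move=> F0 cF; rewrite -nneseries_esumT => [|j]; last by rewrite lee_fin.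
rewrite -EFin_lim//; congr (limn _); apply/funext => n /=.
by rewrite sumEFin.
Qed.

(** One relation for both cases: b = 0 gives [gtn], b = 1 gives [geq], and b becomes the shift of
    the bound J on odd indices. *)
Definition chain_order (b : nat) : rel nat := fun x y => (y < x + b)%N.

Lemma chain_order_odd (b a J j : nat) : (0 < a)%N -> (b < 2)%N ->
  chain_order b (a * J.*2.+1)%N (a * j.*2.+1)%N = (j < J + b)%N.
Proof.
move=> a0; case: b => [|[|//]] _; rewrite /chain_order ?addn0 ?addn1 ?ltnS.
  by rewrite ltn_pmul2l// ltnS ltn_double.
by rewrite leq_pmul2l// ltnS leq_double.
Qed.

Fixpoint chain_val (R : realType) (b : nat) (k : seq nat) (J : nat) : R :=
  if k is x :: k' then
    (\sum_(j < J) oddr R j ^- x * chain_val R b k' (j + b))%R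
  else 1%R.

Lemma chain_val_ge0 (R : realType) (b : nat) (k : seq nat) (J : nat) :
  (0 <= chain_val R b k J)%R.
Proof.
elim: k J => [|x k IH] J //=; apply: sumr_ge0 => j _.
by rewrite mulr_ge0// invr_ge0 exprn_ge0// ler0n.
Qed.

Lemma chain_from_cons (b a n x : nat) :
  chain_from (chain_order b) (2 * a) a n.+1 x =
  chain_top (chain_order b) (2 * a) a n
    [set y | (0 < y)%N && (y == a %[mod 2 * a])%N /\ chain_order b x y].
Proof.
apply/seteqP; split => [m|m [y [cy xy] [m' /andP[pm cm] ->]]] /=.
  case/tupleP: m => y m; rewrite /chain_from /=.
  move=> /andP[/andP[xy pm] /andP[cy cm]].
  by exists y => //; exists m => //; apply/andP.
by rewrite /chain_from /mpos_cong /= xy pm cy; exact: cm.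
Qed.

Lemma sorted_chain_top (b a n : nat) :
  [set m : n.+1.-tuple nat |
    sorted (chain_order b) m && mpos_cong (2 * a) a m] =
  chain_top (chain_order b) (2 * a) a n
    [set y | (0 < y)%N && (y == a %[mod 2 * a])%N /\ True].
Proof.
apply/seteqP; split => [m|m [y [cy _] [m' /andP[pm cm] ->]]] /=.
  case/tupleP: m => y m /= => /andP[pm /andP[cy cm]].
  by exists y => //; exists m => //; apply/andP.
by rewrite pm /mpos_cong /= cy; exact: cm.
Qed.

Lemma natr_oddr (R : realType) (a j x : nat) :
  ((a * j.*2.+1)%:R ^- x = a%:R ^- x * oddr R j ^- x :> R)%R.
Proof. by rewrite natrM exprMn invfM. Qed.

(** The constant c carries the factors of the larger entries, so that all products are formed in R
    before passing to extended reals. *)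
Lemma esum_chain_from (R : realType) (b a n : nat) (k : n.-tuple nat) (J : nat)
    (c : R) : (0 < a)%N -> (b < 2)%N -> (0 <= c)%R ->
  \esum_(m in chain_from (chain_order b) (2 * a) a n (a * J.*2.+1))
    (c * mterm R k m)%:E =
  (c * (a%:R ^- (\sum_(x <- k) x) * chain_val R b k (J + b)))%:E.
Proof.
move=> a0 b2; elim: n k J c => [|n IH] k J c c0.
  rewrite (tuple0 k) /= big_nil expr0 invr1 mul1r.
  rewrite (_ : chain_from _ _ _ _ _ = [set [tuple]]); last first.
    by apply/seteqP; split => m; rewrite (tuple0 m).
  by rewrite esum_set1 /mterm ?big_ord0// lee_fin mulr1.
case/tupleP: k => x k; rewrite chain_from_cons esum_chain_top; last first.
  by move=> m; rewrite lee_fin mulr_ge0// mterm_ge0.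
rewrite esum_oddr//; last first.
  by move=> y; apply: esum_ge0 => m _; rewrite lee_fin mulr_ge0// mterm_ge0.
rewrite (_ : [set j | _] = [set j | (j < J + b)%N]); last first.
  by apply/funext => j; rewrite /= chain_order_odd.
have p0 j : (0 <= c * (a%:R ^- x * oddr R j ^- x))%R.
  by rewrite mulr_ge0// mulr_ge0// invr_ge0 exprn_ge0// ler0n.
rewrite (@eq_esum _ _ _ _ (fun j => (c * (a%:R ^- x * oddr R j ^- x) *
    (a%:R ^- (\sum_(y <- k) y) * chain_val R b k (j + b)))%:E)); last first.
  move=> j _; rewrite -IH//; apply: eq_esum => m _.
  by rewrite mterm_cons natr_oddr mulrA.
rewrite esum_ord; last first.
  by move=> j; rewrite mulr_ge0// mulr_ge0 ?chain_val_ge0// invr_ge0 exprn_ge0.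
congr (_%:E); rewrite /= big_cons exprD invfM !mulr_sumr.
by apply: eq_bigr => j _; ring.
Qed.

(** Discrete form of integrating j^(1/4) / j: the difference on the right is [odd_prod (1 / 4) j.+1]
    times (1/2) / (o + 1/4), and 3 is enough from o = 1 on. *)
Lemma odd_prod_chain (R : realType) (j : nat) :
  (odd_prod (1 / 4) j.+1 / oddr R j <=
   3 * (odd_prod (1 / 4) j.+1 - odd_prod (1 / 4) j))%R.
Proof.
have o1 := oddr_ge1 R j; rewrite odd_prodS.
have x01 : (0 <= (1 / 4 : R) < 1)%R by apply/andP; split; lra.
have := odd_prod_gt0 j x01.
move: (oddr R j) o1 (odd_prod _ _) => o o1 h h0.
rewrite [leRHS](_ : _ = h * ((o + 1 / 4) / (o - 1 / 4)) / o *
  (3 * (o * (1 / 2) / (o + 1 / 4))))%R; last first.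
  by field; do ?[apply/andP; split]; apply: lt0r_neq0; lra.
rewrite ler_pMr; last by rewrite !(mulr_gt0, invr_gt0); lra.
rewrite mulrA ler_pdivlMr; lra.
Qed.

(** Nested sums grow at most like powers of logarithms; bounding them by [odd_prod (1 / 4)] instead
    costs a factor 3 per level and makes [odd_term (1 / 4)] a common majorant. *)
Lemma chain_val_le (R : realType) (b : nat) (k : seq nat) (J : nat) :
  (b < 2)%N -> all (fun x => 0 < x)%N k ->
  (chain_val R b k J <= 3 ^+ size k * odd_prod (1 / 4) J)%R.
Proof.
move=> b2; have x01 : (0 <= (1 / 4 : R) < 1)%R by apply/andP; split; lra.
have mono i : (odd_prod (1 / 4) i <= odd_prod (1 / 4) i.+1 :> R)%R.
  have o1 := oddr_ge1 R i.
  rewrite odd_prodS ler_peMr ?(ltW (odd_prod_gt0 i x01))//.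
  by rewrite ler_pdivlMr; lra.
have ge1 i : (1 <= odd_prod (1 / 4) i :> R)%R.
  elim: i => [|i IH]; last exact: le_trans (mono i).
  by rewrite /odd_prod big_ord0.
elim: k J => [|x k IH] J /=; first by rewrite expr0 mul1r.
move=> /andP[x0 k0].
have -> : (3 ^+ (size k).+1 * odd_prod (1 / 4) J =
    3 ^+ size k * (3 * odd_prod (1 / 4) J) :> R)%R by rewrite exprSr mulrA.
apply: (@le_trans _ _ (3 ^+ size k *
    (3 * (odd_prod (1 / 4) J - odd_prod (1 / 4) 0)))%R); last first.
  rewrite ler_wpM2l ?exprn_ge0// ler_wpM2l// gerBl.
  exact: le_trans (ge1 _).
rewrite -(big_mkord xpredT
  (fun j => oddr R j ^- x * chain_val R b k (j + b))%R).
rewrite -telescope_sumr// !mulr_sumr; apply: ler_sum_nat => j _.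
apply: (@le_trans _ _ (3 ^+ size k * (odd_prod (1 / 4) j.+1 / oddr R j))%R).
  rewrite [leRHS]mulrA mulrC; have o1 := oddr_ge1 R j.
  apply: ler_pM; rewrite ?chain_val_ge0 ?invr_ge0 ?exprn_ge0 ?ler0n//.
    apply: (le_trans (IH _ k0)); rewrite ler_wpM2l ?exprn_ge0//.
    by case: b b2 {IH} => [|[|//]] _; rewrite ?addn0 ?addn1.
  rewrite lef_pV2 ?posrE ?exprn_gt0//; [|lra..].
  by rewrite -[leLHS]expr1 ler_weXn2l.
by rewrite ler_wpM2l ?exprn_ge0// odd_prod_chain.
Qed.

(** Admissibility is used here: o^-2 times [odd_prod (1 / 4) j.+1] is at most twice
    [odd_term (1 / 4) j]. *)
Lemma cvgn_chain_top (R : realType) (b x : nat) (k : seq nat) :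
  (b < 2)%N -> (1 < x)%N -> all (fun y => 0 < y)%N k ->
  cvgn (series (fun j => oddr R j ^- x * chain_val R b k (j + b))%R).
Proof.
move=> b2 x1 k0.
have x04 : (0 <= (1 / 4 : R) <= 1 / 4)%R by apply/andP; split; lra.
have x01 : (0 <= (1 / 4 : R) < 1)%R by apply/andP; split; lra.
apply: (@series_le_cvg _ _
    (fun j => 3 ^+ size k * 2 * odd_term (1 / 4) j)%R).
- by move=> j; rewrite mulr_ge0 ?chain_val_ge0// invr_ge0 exprn_ge0// ler0n.
- by move=> j; rewrite mulr_ge0 ?(ltW (odd_term_gt0 j x01)).
- move=> j; have o1 := oddr_ge1 R j.
  apply: (@le_trans _ _
    (oddr R j ^- 2 * (3 ^+ size k * odd_prod (1 / 4) j.+1))%R).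
    apply: ler_pM; rewrite ?chain_val_ge0 ?invr_ge0 ?exprn_ge0 ?ler0n//.
      by have /andP[] := odd_power_bounds R j x1.
    apply: (le_trans (chain_val_le R _ b2 k0)); rewrite ler_wpM2l ?exprn_ge0//.
    case: b b2 => [|[|//]] _; rewrite ?addn0 ?addn1//.
    rewrite odd_prodS ler_peMr ?(ltW (odd_prod_gt0 j x01))//.
    by rewrite ler_pdivlMr; lra.
  rewrite odd_prodS /odd_term mulrCA -mulrA ler_wpM2l ?exprn_ge0//.
  have := odd_prod_gt0 j x01.
  move: (oddr R j) o1 (odd_prod _ _) => o o1 h h0.
  rewrite [leLHS](_ : _ = 2 * (h / (o * (o - 1 / 4))) *
      ((o + 1 / 4) / (2 * o)))%R; last first.
    by field; do ?[apply/andP; split]; apply: lt0r_neq0; lra.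
  rewrite ler_piMr//.
    by rewrite mulr_ge0// divr_ge0 ?(ltW h0)// mulr_ge0; lra.
  by rewrite ler_pdivrMr; lra.
apply: (@is_cvg_seriesZ _ _ (3 ^+ size k * 2)%R); exact: cvgn_odd_term.
Qed.

Lemma esum_sorted_chain (R : realType) (b a n x : nat) (k : n.-tuple nat) :
  (0 < a)%N -> (b < 2)%N -> (1 < x)%N -> all (fun y => 0 < y)%N k ->
  \esum_(m in [set m : n.+1.-tuple nat |
      sorted (chain_order b) m && mpos_cong (2 * a) a m])
    (mterm R [tuple of x :: k] m)%:E =
  (a%:R ^- (x + \sum_(y <- k) y) *
    limn (series (fun j => oddr R j ^- x * chain_val R b k (j + b))))%:E.
Proof.
move=> a0 b2 x1 k0; rewrite sorted_chain_top esum_chain_top; last first.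
  by move=> m; rewrite lee_fin mterm_ge0.
rewrite (esum_oddr (fun=> True)) //; last first.
  by move=> y; apply: esum_ge0 => m _; rewrite lee_fin mterm_ge0.
rewrite (_ : [set j | True] = setT); last by apply/seteqP.
rewrite (@eq_esum _ _ _ _ (fun j => (a%:R ^- (x + \sum_(y <- k) y) *
    (oddr R j ^- x * chain_val R b k (j + b)))%:E)); last first.
  move=> j _; rewrite [X in X%:E](_ : _ = (a * j.*2.+1)%:R ^- x *
    (a%:R ^- (\sum_(y <- k) y) * chain_val R b k (j + b)))%R; last first.
    by rewrite natr_oddr exprD invfM; ring.
  rewrite -esum_chain_from// ?invr_ge0 ?exprn_ge0//.
  by apply: eq_esum => m _; rewrite mterm_cons.
have cv := @cvgn_chain_top R _ _ _ b2 x1 k0.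
rewrite esum_nat_limn; last 2 first.
- move=> j; have := chain_val_ge0 R b k (j + b) => c0.
  by rewrite !mulr_ge0// invr_ge0 exprn_ge0// ler0n.
- exact: (@is_cvg_seriesZ _ _ (a%:R ^- (x + \sum_(y <- k) y))%R).
congr (_%:E); exact: (@lim_seriesZ _ _ (a%:R ^- (x + \sum_(y <- k) y))%R).
Qed.

(** * Comparison with the generating function *)

Local Open Scope ring_scope.

(** The ambient type keeps the bound k while the weight w decreases along the induction; this loses
    nothing, as entries never exceed the weight. *)
Lemma sum_chain_val (R : realType) (b k n J w : nat) : (w <= k)%N ->
  \sum_(s : n.-tuple 'I_k.+1 | all (fun x : 'I_k.+1 => (0 < x)%N) s
        && (\sum_(x <- s) (x : nat) == w)%N) chain_val R b (map val s) J =
  chain_sum R b n J w.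
Proof.
elim: n J w => [|n IH] J w wk.
  rewrite /= [w == 0%N]eq_sym big_mkcond (big_pred1 [tuple]); last first.
    by move=> s; apply/esym/eqP; exact: tuple0.
  by rewrite /= big_nil; case: eqP.
rewrite big_tuple_cons /=.
under eq_bigr => x _ do under eq_bigr => s _ do rewrite /=.
transitivity (\sum_(x < k.+1 | (0 < x)%N && (x <= w)%N)
    \sum_(j < J) oddr R j ^- x * chain_sum R b n (j + b) (w - x)).
  rewrite [RHS]big_mkcond; apply: eq_bigr => x _.
  case: ifPn => [/andP[x0 xw]|xw].
    rewrite exchange_big /=; apply: eq_bigr => j _.
    rewrite -IH; last by rewrite (leq_trans (leq_subr _ _)).
    rewrite mulr_sumr; apply: eq_bigl => s; rewrite x0 big_cons /=.
    by rewrite -{1}(subnKC xw) eqn_add2l.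
  rewrite big_pred0// => s; apply/negbTE; apply: contra xw.
  by rewrite big_cons => /andP[/andP[-> _] /eqP <-]; rewrite leq_addr.
rewrite exchange_big /=; apply: eq_bigr => j _.
rewrite big_nat_cond (big_nat_widen _ _ k.+1)// (big_nat_widenl 1 0)//.
rewrite big_mkord.
by apply: eq_bigl => x; lia.
Qed.

Definition head_sum (R : realType) (b n k j : nat) : R :=
  \sum_(x < k.+1 | (1 < x)%N) oddr R j ^- x * chain_sum R b n (j + b) (k - x).

Lemma sum_I0_head (R : realType) (b n k j : nat) :
  \sum_(x < k.+1) \sum_(s : n.-tuple 'I_k.+1 | [tuple of x :: s] \in I0 k n.+1)
    oddr R j ^- x * chain_val R b (map val s) (j + b) = head_sum R b n k j.
Proof.
rewrite /head_sum [RHS]big_mkcond; apply: eq_bigr => x _; case: ifPn => x1.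
  rewrite -(@sum_chain_val _ _ k) ?leq_subr// mulr_sumr; apply: eq_bigl => s.
  rewrite inE /= x1 big_cons (ltnW x1) /=.
  by rewrite -[in RHS](eqn_add2l x) subnKC// -ltnS.
by rewrite big_pred0// => s; rewrite inE /= (negbTE x1) andbF.
Qed.

Local Open Scope ereal_scope.

Definition chain_G (R : realType) (b a k n : nat) : \bar R :=
  \sum_(s in I0 k n) \esum_(m in [set m : n.-tuple nat |
      sorted (chain_order b) m && mpos_cong (2 * a) a m])
    (mterm R (map_tuple val s) m)%:E.

(** Convergence is stated with the value, because the limits of the [head_sum] series are added up
    afterwards with signs. *)
Lemma chain_GE (R : realType) (b a k n : nat) : (0 < a)%N -> (b < 2)%N ->
  cvgn (series (head_sum R b n k)) /\
  chain_G R b a k n.+1 =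
  (a%:R ^- k * limn (series (head_sum R b n k)))%:E.
Proof.
move=> a0 b2.
have memI0 (x : 'I_k.+1) (s : n.-tuple 'I_k.+1) :
    [tuple of x :: s] \in I0 k n.+1 ->
    [/\ (1 < x)%N, all (fun y => 0 < y)%N (map_tuple val s) &
        (x + \sum_(y <- map_tuple val s) y = k)%N].
  rewrite inE /= big_cons => /and3P[/andP[_ s0] x1 /eqP xs]; split => //.
    by rewrite all_map.
  by rewrite big_map.
have cv : series (head_sum R b n k) @ \oo --> (\sum_(x < k.+1)
    \sum_(s : n.-tuple 'I_k.+1 | [tuple of x :: s] \in I0 k n.+1)
    limn (series (fun j => oddr R j ^- x *
      chain_val R b (map_tuple val s) (j + b))))%R.
  rewrite (_ : series _ = fun N => (\sum_(x < k.+1)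
    \sum_(s : n.-tuple 'I_k.+1 | [tuple of x :: s] \in I0 k n.+1)
    series (fun j => oddr R j ^- x *
      chain_val R b (map_tuple val s) (j + b)) N)%R); last first.
    apply/funext => N; rewrite seriesEord /=.
    under eq_bigr do rewrite -sum_I0_head.
    rewrite exchange_big /=; apply: eq_bigr => x _.
    rewrite exchange_big /=; apply: eq_bigr => s _.
    by rewrite seriesEord.
  apply: cvg_sumr => x _; apply: cvg_sumr => s /memI0[x1 s0 _].
  exact: cvgn_chain_top.
split; first exact: cvgP cv.
rewrite /chain_G big_tuple_cons (cvg_lim _ cv)// mulr_sumr -sumEFin.
apply: eq_bigr => x _; rewrite mulr_sumr -sumEFin; apply: eq_bigr => s xs.
have [x1 s0 xsk] := memI0 _ _ xs.
rewrite (_ : map_tuple val _ = [tuple of (x : nat) :: map_tuple val s]);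
  last exact: val_inj.
by rewrite esum_sorted_chain// xsk.
Qed.

Lemma top_gen_head_sum (R : realType) (b w j : nat) : (b < 2)%N ->
  top_gen R b j w = (\sum_(n < w.+1)
    ((-1) ^+ b) ^+ (w - n) * 2 ^+ n * head_sum R b n w.+2 j)%R.
Proof.
move=> b2; rewrite /top_gen /head_sum.
under [RHS]eq_bigr do rewrite big_mkcond /= 2!big_ord_recl /= !add0r mulr_sumr.
rewrite exchange_big /=; apply: eq_bigr => i _.
rewrite (@chain_genE _ _ _ _ w.+1) ?ltnS ?leq_subr// mulr_sumr.
apply: eq_bigr => n _; rewrite /bump /= !add1n !subSS.
have -> : (((-1) ^+ b) ^+ (w - n) =
    ((-1) ^+ b) ^+ i * ((-1) ^+ b) ^+ (w - i + n) :> R)%R.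
  rewrite -exprD; case: b b2 => [|[|//]] _; rewrite ?expr0 ?expr1n// expr1.
  have nw : (n <= w)%N by rewrite -ltnS.
  have iw : (i <= w)%N by rewrite -ltnS.
  have -> : (i + (w - i + n) = w - n + n.*2)%N by lia.
  by rewrite exprD -muln2 mulnC exprM sqrrN !expr1n mulr1.
ring.
Qed.

(** By [top_gen_weak_strict] the limit on the right does not depend on b, so both sides of the first
    equality are instances of this identity. *)
Lemma sum_chain_G (R : realType) (b a w : nat) : (0 < a)%N -> (b < 2)%N ->
  \sum_(n < w.+1)
    (((-1) ^+ b) ^+ (w - n) * 2 ^+ n)%R%:E * chain_G R b a w.+2 n.+1 =
  (a%:R ^- w.+2 * limn (series (fun j => top_gen R 0 j w)))%:E.
Proof.
move=> a0 b2.
have e : (fun j => top_gen R 0 j w) = (fun j => top_gen R b j w).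
  case: b b2 => [|[|//]] _ //; apply/funext => j.
  by rewrite top_gen_weak_strict.
rewrite e; have -> : limn (series (fun j => top_gen R b j w)) = (\sum_(n < w.+1)
    ((-1) ^+ b) ^+ (w - n) * 2 ^+ n * limn (series (head_sum R b n w.+2)))%R.
  apply/cvg_lim => //.
  rewrite (_ : series _ = fun N => (\sum_(n < w.+1)
    ((-1) ^+ b) ^+ (w - n) * 2 ^+ n * series (head_sum R b n w.+2) N)%R).
    apply: cvg_sumr => n _; apply: cvgMr.
    by have [] := @chain_GE R b a w.+2 n a0 b2.
  apply/funext => N; rewrite seriesEord /=.
  under eq_bigr do rewrite top_gen_head_sum//.
  rewrite exchange_big; apply: eq_bigr => n _.
  by rewrite seriesEord /= mulr_sumr.
rewrite mulr_sumr -sumEFin; apply: eq_bigr => n _.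
have [_ ->] := @chain_GE R b a w.+2 n a0 b2.
by rewrite -EFinM; congr (_%:E); ring.
Qed.

Lemma t_odd_zeta (R : realType) (n : nat) : (2 <= n)%N -> t R n = odd_zeta R n.
Proof.
move=> n2; rewrite /t /tNa.
rewrite (_ : [set m | _] = [set m : 1.-tuple nat |
    sorted (chain_order 0) m && mpos_cong (2 * 1) 1 m]); last first.
  by apply/funext => m; case/tupleP: m => x m; rewrite (tuple0 m).
rewrite (_ : [tuple n] = [tuple of n :: [tuple]]); last exact: val_inj.
rewrite esum_sorted_chain//= big_nil expr1n invr1 mul1r.
by congr (limn (series _)); apply/funext => j; rewrite mulr1.
Qed.

(** Since 2^i - 2 = 2 (2^(i-1) - 1), each part n_i brings a factor 4; their product is the 2^(2m) of
    the theorem. *)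
Lemma log_coefE (R : realType) (i : nat) : (2 <= i)%N ->
  (log_coef R i = 4 * (2 ^+ i.-1 - 1) * t R i / (i%:R * (2 ^+ i - 1)))%R.
Proof.
case: i => [|i] // i2; rewrite /log_coef t_odd_zeta//.
have p0 : (2 ^+ i.+1 - 1 != 0 :> R)%R.
  by rewrite subr_eq0 gt_eqF// exprn_egt1// ltr1n.
have := alt_power_sumE R i2 => /(canRL (mulfK p0)) ->.
rewrite /= exprS in p0 *.
have i0 : (i.+1%:R != 0 :> R)%R by rewrite pnatr_eq0.
move: (i.+1%:R) i0 (2 ^+ i)%R p0 => x x0 y y0; field.
by rewrite y0 x0.
Qed.

Lemma rhs_sumE (R : realType) (a w : nat) : (0 < a)%N ->
  rhs_sum R a w.+2 = (a%:R ^- w.+2 * expand_coef R w)%R.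
Proof.
move=> a0; rewrite /rhs_sum /expand_coef /= !mulr_sumr subn2 /=.
apply: eq_bigr => n _; rewrite !mulr_sumr; apply: eq_bigr => m _.
rewrite !mulr_sumr; apply: eq_bigr => s /andP[s2 _].
rewrite /rhs_term odd_sum0 -t_odd_zeta// !big_map.
have prodE (r : seq 'I_w.+1) : all (fun x : 'I_w.+1 => (2 <= x)%N) r ->
    (\prod_(x <- r) log_coef R x = 4 ^+ size r *
    \prod_(x <- r) (2 ^+ (x : nat).-1 - 1) * \prod_(x <- r) t R x /
    \prod_(x <- r) ((x : nat)%:R * (2 ^+ x - 1)))%R.
  elim: r => [|x r IH] /=; first by rewrite !big_nil expr0 invr1 !mulr1.
  by move=> /andP[x2 r2]; rewrite !big_cons IH// log_coefE// !invfM exprS; ring.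
rewrite (prodE s s2) size_tuple.
have -> : (4 ^+ m = 2 ^+ (2 * m) :> R)%R.
  by rewrite exprM; congr (_ ^+ _)%R; ring.
rewrite !invfM exprD exprMn; ring.
Qed.

Lemma G0_chain (R : realType) (a k n : nat) :
  G0 R (2 * a) a k n = chain_G R 0 a k n.
Proof.
apply: eq_bigr => s _; congr (\esum_(m in _) _); apply/funext => m /=.
have -> : chain_order 0 = gtn; last by [].
by apply/funext => x; apply/funext => y; rewrite /chain_order addn0.
Qed.

Lemma G0star_chain (R : realType) (a k n : nat) :
  G0star R (2 * a) a k n = chain_G R 1 a k n.
Proof.
apply: eq_bigr => s _; congr (\esum_(m in _) _); apply/funext => m /=.
have -> : chain_order 1 = geq; last by [].
by apply/funext => x; apply/funext => y; rewrite /chain_order addn1 ltnS.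
Qed.

Theorem corollary2p12 (R : realType) (a k : nat) (ha : (0 < a)%N)
    (hk : (2 <= k)%N) :
  (\sum_(1 <= n < k) (2 ^+ n.-1)%R%:E * G0 R (2 * a)%N a k n
   = \sum_(1 <= n < k)
       ((-1) ^+ (k - n - 1)%N * 2 ^+ n.-1)%R%:E * G0star R (2 * a)%N a k n)
  /\
  (\sum_(1 <= n < k)
       ((-1) ^+ (k - n - 1)%N * 2 ^+ n.-1)%R%:E * G0star R (2 * a)%N a k n
   = (rhs_sum R a k)%:E).
Proof.
case: k hk => [|[|w]] // _.
rewrite rhs_sumE// -top_gen_sum.
have weak : \sum_(1 <= n < w.+2) ((-1) ^+ (w.+2 - n - 1)%N * 2 ^+ n.-1)%R%:E *
      G0star R (2 * a)%N a w.+2 n =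
    (a%:R ^- w.+2 * limn (series (fun j => top_gen R 0 j w)))%:E.
  rewrite -(@sum_chain_G _ 1)// big_add1 big_mkord; apply: eq_bigr => n _.
  by rewrite G0star_chain expr1 (_ : w.+2 - n.+1 - 1 = w - n)%N//; lia.
split; rewrite weak//.
rewrite -(@sum_chain_G _ 0)// big_add1 big_mkord; apply: eq_bigr => n _.
by rewrite G0_chain expr0 expr1n mul1r.
Qed.
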